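(* There exists a universal constant $c_0>0$ such that, for every finite set $M$, every proper nonempty subset $V\subset M$ of cardinality $v$, and every irreducible Markov generator $L$ on $M$ which is reversible with respect to its invariant probability $\mu$, the eigenvalues $\sigma_1(M)\le\dots\le\sigma_v(M)$ of $-S$, where $S$ is the Steklov operator on $V$ associated to $L$, satisfy $$\forall k\in\{1,\dots,v\},\qquad \sigma_k(M)\ \ge\ \frac{c_0}{k^6}\,\frac{\iota_k(M)}{\|L\|},$$ where $\iota_k(M)$ is the $k$-th Cheeger–Steklov constant and $\|L\|$ is the largest absolute value of the diagonal entries of $L$.
   Context: Let $M$ be a finite set and $\emptyset\ne V\subsetneq M$. For a finite set $E$, $\mathcal F(E)$ is the space of real functions on $E$. A Markov generator is a matrix $L=(L(x,y))_{x,y\in M}$ with $L(x,y)\ge 0$ for $x\ne y$ and $\sum_{y}L(x,y)=0$ for all $x$; it acts by $L[F](x)=\sum_y L(x,y)F(y)$. It is irreducible if for all $x,y\in M$ there are $x=x_0,\dots,x_l=y$ with $L(x_j,x_{j+1})>0$ for $0\le j\le l-1$. Then $\mu$ denotes its unique invariant probability ($\sum_x\mu(x)L(x,y)=0$ for all $y$). Reversible means $\mu(x)L(x,y)=\mu(y)L(y,x)$ for all $x,y$. Steklov operator $S$ on $\mathcal F(V)$: for $f\in\mathcal F(V)$ let $F\in\mathcal F(M)$ be the unique function with $L[F]=0$ on $M\setminus V$ and $F=f$ on $V$; set $S[f](x)=L[F](x)$ for $x\in V$. In the reversible case the eigenvalues of $-S$ are real and nonnegative, listed with multiplicity as $0=\sigma_1\le\sigma_2\le\dots\le\sigma_v$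 ($\sigma_k=\sigma_k(M)$). Let $\mathcal A$ be the set of nonempty subsets of $M$ and $\mathcal A_k$ the set of $k$-tuples of pairwise disjoint elements of $\mathcal A$. For $A\in\mathcal A$, $\partial A=\{(x,y): x\in A,\ y\in M\setminus A\}$. Let $\underline{\mu}$ be the measure on $M\times M$ with $\underline\mu(x,y)=\mu(x)L(x,y)$ if $x\ne y$ and $\underline\mu(x,x)=0$. Define $$\eta(A)=\frac{\underline\mu(\partial A)}{\mu(A)},\qquad \eta'(A)=\frac{\underline\mu(\partial A)}{\mu(A\cap V)}\quad(\eta'(A)=+\infty\text{ if }A\cap V=\emptyset),$$ $$\rho(A)=\min_{B\in\mathcal A,\,B\subseteq A}\eta(B),\qquad \rho'(A)=\min_{B\in\mathcal A,\,B\subseteq A}\eta'(B),$$ $$\iota_k(M)=\min_{(A_1,\dots,A_k)\in\mathcal A_k}\ \max_{1\le l\le k}\rho(A_l)\rho'(A_l).$$ *)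

(* Defs.v *)
From HB Require Import structures.
From mathcomp Require Import all_boot all_order all_algebra.
From mathcomp Require Import boolp classical_sets reals constructive_ereal ereal.

Set Implicit Arguments.
Unset Strict Implicit.
Unset Printing Implicit Defensive.

Import Order.TTheory GRing.Theory Num.Theory.

Local Open Scope ring_scope.

Section Generators.
Variables (R : realType) (M : finType).
Implicit Types (L : M -> M -> R) (mu : M -> R).

Definition markov_generator L : Prop :=
  (forall x y, x != y -> 0 <= L x y) /\ (forall x, \sum_y L x y = 0).

Definition gen_act L (F : {ffun M -> R}) : {ffun M -> R} :=
  [ffun x => \sum_y L x y * F y].

(* [connect] allows the path of length 0 from x to x; on at least two points
   this does not change the notion. *)
Definition irreducible_generator L : Prop :=
  forall x y, connect [rel a b | 0 < L a b] x y.

Definition invariant_probability L mu : Prop :=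
  [/\ forall x, 0 <= mu x, \sum_x mu x = 1
    & forall y, \sum_x mu x * L x y = 0].

Definition reversible L mu : Prop :=
  forall x y, mu x * L x y = mu y * L y x.

Definition gen_norm L : R := \big[Num.max/0]_x `|L x x|.

End Generators.

Section Spectrum.
Variable R : realType.

(* Matrix of a linear operator on the functions on E, in the basis of the
   indicator functions of points. *)
Definition op_mx (E : finType) (T : {ffun E -> R} -> {ffun E -> R}) :
    'M[R]_#|E| :=
  \matrix_(i, j) T [ffun z => (z == enum_val j)%:R] (enum_val i).

Definition is_spectrum n (A : 'M[R]_n) (s : seq R) : Prop :=
  sorted <=%R s /\ char_poly A = \prod_(a <- s) ('X - a%:P).

(* There is at most one such sequence; [::] is the fallback value used when
   the characteristic polynomial does not split over R. *)
Definition spectrum n (A : 'M[R]_n) : seq R := xget [::] (is_spectrum A).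

End Spectrum.

Section Steklov.
Variables (R : realType) (M : finType) (V : {set M}) (L : M -> M -> R).

Definition is_harmonic_ext (f : {ffun {x : M | x \in V} -> R})
    (F : {ffun M -> R}) : Prop :=
  (forall x, x \notin V -> gen_act L F x = 0) /\
  (forall x : {x : M | x \in V}, F (val x) = f x).

(* When L is an irreducible Markov generator and V is nonempty, exactly one
   function satisfies [is_harmonic_ext f], so the fallback 0 is not used. *)
Definition harmonic_ext (f : {ffun {x : M | x \in V} -> R}) : {ffun M -> R} :=
  xget 0 (is_harmonic_ext f).

Definition steklov (f : {ffun {x : M | x \in V} -> R}) :
    {ffun {x : M | x \in V} -> R} :=
  [ffun x => gen_act L (harmonic_ext f) (val x)].

Definition steklov_eigenvalues : seq R := spectrum (- op_mx steklov).

(* Eigenvalues are numbered from 1. *)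
Definition sigma (k : nat) : R := nth 0 steklov_eigenvalues k.-1.

End Steklov.

Section Cheeger.
Variables (R : realType) (M : finType) (V : {set M}).
Variables (L : M -> M -> R) (mu : M -> R).

Definition set_mass (A : {set M}) : R := \sum_(x in A) mu x.

Definition edge_mass (x y : M) : R := if x == y then 0 else mu x * L x y.

Definition edge_boundary (A : {set M}) : {set M * M} := finset.setX A (~: A).

Definition flow_out (A : {set M}) : R :=
  \sum_(e in edge_boundary A) edge_mass e.1 e.2.

Definition eta (A : {set M}) : \bar R := (flow_out A / set_mass A)%:E.

Definition eta' (A : {set M}) : \bar R :=
  if A :&: V == finset.set0 then +oo%E
  else (flow_out A / set_mass (A :&: V))%:E.

Definition rho (A : {set M}) : \bar R :=
  \big[mine/+oo%E]_(B : {set M} | (B != finset.set0) && (B \subset A)) eta B.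

Definition rho' (A : {set M}) : \bar R :=
  \big[mine/+oo%E]_(B : {set M} | (B != finset.set0) && (B \subset A)) eta' B.

Definition disjoint_family k (A : {ffun 'I_k -> {set M}}) : bool :=
  [forall l, A l != finset.set0] &&
  [forall l, forall m, (l != m) ==> [disjoint A l & A m]].

Definition cheeger_steklov (k : nat) : \bar R :=
  \big[mine/+oo%E]_(A : {ffun 'I_k -> {set M}} | disjoint_family A)
    \big[maxe/-oo%E]_(l < k) (rho (A l) * rho' (A l))%E.

End Cheeger.

(* Main.v *)
(* Orthonormal eigenfunctions for the k lowest Steklov eigenvalues, extended
   harmonically to M, define a map F of M into a Euclidean space whose
   Dirichlet energy is at most k * sigma_k and whose mass on V is isotropic.
   Hence a set on which the direction F / |F| varies by at most order
   k ^ (- 1/2) carries mass at most 1 + O(1 / k) out of the total mass k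
   (Lee, Oveis Gharan and Trevisan).  Cut the cube containing all directions
   into a grid of small cubes and damp |F| near the grid walls.  Averaging over
   N = O(k ^ 2) translates of the grid, whose walls have disjoint
   neighbourhoods, yields one translate for which little mass is lost and the
   energy grows by a factor O(k ^ 4) only.  Merging the small cubes greedily
   gives k disjointly supported functions of mass at least 1/2 and energy
   O(k ^ 5 * sigma_k).  A Cheeger inequality of Jammes type bounds
   rho(A) * rho'(A) on the support A of each of them by ||L|| times its
   Rayleigh quotient. *)
Require Import Defs.
From HB Require Import structures.
From mathcomp Require Import all_boot all_order all_algebra.
From mathcomp Require Import boolp classical_sets reals constructive_ereal ereal.
From mathcomp Require Import spectral complex ring lra zify.

Set Implicit Arguments.
Unset Strict Implicit.
Unset Printing Implicit Defensive.

Import Order.TTheory GRing.Theory Num.Theory.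

Local Open Scope ring_scope.

(** * Layer cake and the Cheeger inequality *)

Section Coarea.
Variables (R : realType) (M : finType) (w : M -> M -> R).

(** Induction on the size of the support [B] of [g]. Lowering [g] on [B] by its least positive value
    [m] removes [m] times the mass of [B] on the left and [m] times the flow out of [B] on the
    right, which the hypothesis compares. *)
Lemma layer_cake_le (nu : M -> R) (A : {set M}) (r : R) :
  (forall B : {set M}, B != finset.set0 -> B \subset A ->
     r * \sum_(x in B) nu x <= \sum_(x in B) \sum_(y in ~: B) w x y) ->
  forall g : M -> R, (forall x, 0 <= g x) -> (forall x, x \notin A -> g x = 0) ->
  r * \sum_x nu x * g x <= \sum_x \sum_y w x y * Num.max (g x - g y) 0.
Proof.
move=> hA g; move: {2}#|[set x | g x != 0]| (leqnn #|[set x | g x != 0]|) => n.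
elim: n g => [|n IH] g card_g g0 gA.
  have gz x : g x = 0.
    apply/eqP; apply: contraT => gx.
    by move: card_g; rewrite leqn0 cards_eq0 => /eqP/setP/(_ x); rewrite !inE gx.
  rewrite big1 ?mulr0; last by move=> x _; rewrite gz mulr0.
  rewrite big1 // => x _; rewrite big1 // => y _.
  by rewrite !gz subr0 maxxx mulr0.
set B := [set x | g x != 0].
have [B0|B0] := eqVneq B finset.set0.
  by apply: IH => //; rewrite -/B B0 cards0.
have [b bB] := set0Pn _ B0.
have [c cB cmin] : exists2 c, c \in B & forall y, y \in B -> g c <= g y.
  by case: (@arg_minP _ _ _ b (mem B) g bB) => c cB cmin; exists c.
set m := g c in cmin.
have m0 : 0 < m by rewrite lt_def g0 andbT; move: cB; rewrite inE.
have gB x : (x \in B) = (g x != 0) by rewrite inE.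
have gNB x : x \notin B -> g x = 0 by rewrite gB negbK => /eqP.
pose h x := if x \in B then g x - m else 0.
have hB : B \subset A.
  by apply/fintype.subsetP => x; rewrite gB; apply: contraR => /gA ->.
have h0 x : 0 <= h x by rewrite /h; case: ifP => // /cmin; rewrite subr_ge0.
have hsA x : x \notin A -> h x = 0.
  by move=> xA; rewrite /h; case: ifP => // /(fintype.subsetP hB); rewrite (negbTE xA).
have card_h : (#|[set x | h x != 0%R]| <= n)%N.
  rewrite -ltnS; apply: leq_trans card_g; apply: proper_card.
  apply/properP; split.
    by apply/fintype.subsetP => x; rewrite !inE /h gB; case: ifP => // _; rewrite eqxx.
  by exists c => //; rewrite inE /h cB subrr eqxx.
have := IH h card_h h0 hsA.
have := ler_wpM2l (ltW m0) (hA B B0 hB).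
have -> : \sum_x nu x * g x = \sum_x nu x * h x + m * \sum_(x in B) nu x.
  rewrite mulr_sumr [X in _ = _ + X]big_mkcond -big_split /=.
  apply: eq_bigr => x _; rewrite /h; case: ifPn => xB; first by ring.
  by rewrite (gNB x) // addr0.
have -> : \sum_x \sum_y w x y * Num.max (g x - g y) 0 =
   \sum_x \sum_y w x y * Num.max (h x - h y) 0 +
   m * \sum_(x in B) \sum_(y in ~: B) w x y.
  rewrite mulr_sumr [X in _ = _ + X]big_mkcond -big_split /=.
  apply: eq_bigr => x _; case: (boolP (x \in B)) => xB.
    rewrite mulr_sumr [X in _ = _ + X]big_mkcond -big_split /=.
    apply: eq_bigr => y _; rewrite inE /h xB; case: (boolP (y \in B)) => yB /=.
      by rewrite addr0; congr (_ * Num.max _ _); ring.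
    rewrite (gNB y) // !subr0.
    rewrite !max_l //; [by ring|by rewrite subr_ge0 cmin].
  rewrite addr0; apply: eq_bigr => y _; congr (_ * _).
  rewrite /h (negbTE xB) (gNB x) // !sub0r !max_r ?oppr_le0 //; exact: h0.
by rewrite !mulrDr !mulrA ![m * r]mulrC; lra.
Qed.

Lemma sum_symm_max (g : M -> R) : (forall x y, w x y = w y x) ->
  2 * (\sum_x \sum_y w x y * Num.max (g x - g y) 0) =
  \sum_x \sum_y w x y * `|g x - g y|.
Proof.
move=> wC; rewrite mulr_natl mulr2n {2}exchange_big -big_split /=.
apply: eq_bigr => x _; rewrite -big_split /=; apply: eq_bigr => y _.
rewrite (wC y x) -mulrDr; congr (_ * _).
case: (lerP (g x) (g y)) => h.
  by rewrite max_r ?max_l; lra.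
by rewrite max_l ?max_r; lra.
Qed.

End Coarea.

(** The form [sum w (s a - t b)^2] is nonnegative; the choice [s = X], [t = A] gives the claim after
    division by [A]. *)
Lemma cauchy_schwarz_sum (R : realFieldType) (I : finType) (w a b : I -> R) :
  (forall i, 0 <= w i) ->
  (\sum_i w i * (a i * b i)) ^+ 2 <=
  (\sum_i w i * a i ^+ 2) * (\sum_i w i * b i ^+ 2).
Proof.
move=> w0; set X := \sum_i _ * (_ * _); set A := \sum_i w i * a i ^+ 2.
set B := \sum_i w i * b i ^+ 2.
have quad s t : 0 <= s ^+ 2 * A - 2 * s * t * X + t ^+ 2 * B.
  rewrite /A /B /X !mulr_sumr -sumrB -big_split /=; apply: sumr_ge0 => i _.
  have -> : s ^+ 2 * (w i * a i ^+ 2) - 2 * s * t * (w i * (a i * b i)) +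
    t ^+ 2 * (w i * b i ^+ 2) = w i * (s * a i - t * b i) ^+ 2 by ring.
  by rewrite mulr_ge0 // sqr_ge0.
have A0 : 0 <= A by apply: sumr_ge0 => i _; rewrite mulr_ge0 ?sqr_ge0.
have [A00|Ap] := eqVneq A 0.
  (* For [A = 0] these values turn the form into [- X^4 (B + 2)], so [X = 0]. *)
  have := quad (X * (B + 1)) (X ^+ 2 * 1); rewrite A00.
  have B0 : 0 <= B by apply: sumr_ge0 => i _; rewrite mulr_ge0 ?sqr_ge0.
  rewrite mul0r; nra.
have Apos : 0 < A by rewrite lt_def Ap.
have := quad X A; have -> : X ^+ 2 * A - 2 * X * A * X + A ^+ 2 * B =
  A * (A * B - X ^+ 2) by ring.
by rewrite pmulr_rge0 // subr_ge0.
Qed.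

(** * Jammes-type inequality for a symmetric weight and two measures *)

Section CheegerStep.
Variables (R : realType) (M : finType) (w : M -> M -> R) (mu : M -> R) (l : R).
Hypothesis w0 : forall x y, 0 <= w x y.
Hypothesis wC : forall x y, w x y = w y x.
Hypothesis mu0 : forall x, 0 < mu x.
Hypothesis wl : forall x, \sum_y w x y <= l * mu x.

Lemma sum_sqrD_le (psi : M -> R) :
  \sum_x \sum_y w x y * (psi x + psi y) ^+ 2 <=
  4 * l * \sum_x mu x * psi x ^+ 2.
Proof.
have -> : 4 * l * \sum_x mu x * psi x ^+ 2 =
    4 * \sum_x l * mu x * psi x ^+ 2.
  by rewrite -mulrA mulr_sumr; under [in RHS]eq_bigr do rewrite -mulrA.
apply: (@le_trans _ _ (4 * \sum_x (\sum_y w x y) * psi x ^+ 2)); last first.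
  rewrite ler_wpM2l //; apply: ler_sum => x _.
  by rewrite ler_wpM2r ?sqr_ge0.
have -> : 4 * \sum_x (\sum_y w x y) * psi x ^+ 2 =
   \sum_x \sum_y w x y * (2 * (psi x ^+ 2 + psi y ^+ 2)).
  have -> : \sum_x \sum_y w x y * (2 * (psi x ^+ 2 + psi y ^+ 2)) =
     2 * (\sum_x \sum_y w x y * psi x ^+ 2) + 2 * (\sum_x \sum_y w x y * psi y ^+ 2).
    rewrite !mulr_sumr -big_split /=; apply: eq_bigr => x _.
    rewrite !mulr_sumr -big_split /=; apply: eq_bigr => y _; ring.
  have -> : \sum_x \sum_y w x y * psi y ^+ 2 = \sum_x \sum_y w x y * psi x ^+ 2.
    rewrite exchange_big /=; apply: eq_bigr => x _; apply: eq_bigr => y _.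
    by rewrite wC.
  rewrite -mulrDl -natrD; congr (_ * _); apply: eq_bigr => x _.
  by rewrite mulr_suml.
apply: ler_sum => x _; apply: ler_sum => y _; rewrite ler_wpM2l //.
by rewrite -subr_ge0; have := sqr_ge0 (psi x - psi y); congr (_ <= _); ring.
Qed.

(* Two layer-cake bounds share one factor Y = sum w |psi x ^ 2 - psi y ^ 2|:
   r P <= Y / 2 and r' P' <= Y / 2, while Cauchy-Schwarz gives
   Y ^ 2 <= 4 l P D; the unrestricted mass P cancels. *)
Lemma cheeger_product_le (nu psi : M -> R) (A : {set M}) (r r' : R) :
  (forall x, 0 <= nu x) -> 0 <= r -> 0 <= r' ->
  (forall B : {set M}, B != finset.set0 -> B \subset A ->
     r * \sum_(x in B) mu x <= \sum_(x in B) \sum_(y in ~: B) w x y) ->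
  (forall B : {set M}, B != finset.set0 -> B \subset A ->
     r' * \sum_(x in B) nu x <= \sum_(x in B) \sum_(y in ~: B) w x y) ->
  (forall x, 0 <= psi x) -> (forall x, x \notin A -> psi x = 0) ->
  r * r' * (\sum_x nu x * psi x ^+ 2) <=
  l * \sum_x \sum_y w x y * (psi x - psi y) ^+ 2.
Proof.
move=> nu0 r0 r'0 hr hr' psi0 psiA.
set D := \sum_x \sum_y _ * (_ - _) ^+ 2.
pose Y := \sum_x \sum_y w x y * `|psi x ^+ 2 - psi y ^+ 2|.
pose P := \sum_x mu x * psi x ^+ 2; set P' := \sum_x nu x * _.
have g0 x : 0 <= psi x ^+ 2 by rewrite sqr_ge0.
have gA x : x \notin A -> psi x ^+ 2 = 0 by move=> /psiA ->; rewrite expr0n.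
have yE := @sum_symm_max _ _ w (fun x => psi x ^+ 2) wC.
have h1 : 2 * (r * P) <= Y.
  by rewrite /Y -yE ler_pM2l //; exact: (layer_cake_le hr).
have h2 : 2 * (r' * P') <= Y.
  by rewrite /Y -yE ler_pM2l //; exact: (layer_cake_le hr').
have D0 : 0 <= D.
  by apply: sumr_ge0 => x _; apply: sumr_ge0 => y _; rewrite mulr_ge0 ?sqr_ge0.
have h3 : Y ^+ 2 <= D * (4 * l * P).
  have := @cauchy_schwarz_sum R (M * M)%type (fun p => w p.1 p.2)
    (fun p => `|psi p.1 - psi p.2|) (fun p => psi p.1 + psi p.2) (fun p => w0 _ _).
  have -> : \sum_i w i.1 i.2 * (`|psi i.1 - psi i.2| * (psi i.1 + psi i.2)) = Y.
    rewrite /Y pair_bigA /=; apply: eq_bigr => i _.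
    by rewrite subr_sqr normrM [in RHS](ger0_norm (addr_ge0 (psi0 _) (psi0 _))).
  move=> h; apply: (le_trans h); clear h.
  have -> : \sum_i w i.1 i.2 * `|psi i.1 - psi i.2| ^+ 2 = D.
    rewrite /D pair_bigA /=; apply: eq_bigr => i _.
    by rewrite real_normK // num_real.
  rewrite ler_wpM2l // -(pair_bigA _ (fun x y => w x y * (psi x + psi y) ^+ 2)) /=.
  exact: sum_sqrD_le.
have P0 : 0 <= P by apply: sumr_ge0 => x _; rewrite mulr_ge0 // ltW.
have P'0 : 0 <= P' by apply: sumr_ge0 => x _; rewrite mulr_ge0.
(* Cancelling [P] requires [P > 0]. If [P = 0], positivity of [mu] forces [psi = 0] and both sides
   vanish. *)
have [Pz|Pn] := eqVneq P 0.
  have pz x : psi x ^+ 2 = 0.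
    have := psumr_eq0P (fun x _ => mulr_ge0 (ltW (mu0 x)) (g0 x)) Pz.
    by move=> /(_ x isT) /eqP; rewrite mulf_eq0 gt_eqF //= => /eqP.
  rewrite /P' big1; last by move=> x _; rewrite pz mulr0.
  rewrite /D big1 ?mulr0 // => x _; rewrite big1 // => y _.
  have z t : psi t = 0 by move: (pz t) => /eqP; rewrite expf_eq0 => /eqP.
  by rewrite !z subr0 expr0n mulr0.
have Pp : 0 < P by rewrite lt_def Pn.
have Y0 : 0 <= Y by apply: sumr_ge0 => x _; apply: sumr_ge0 => y _; rewrite mulr_ge0.
rewrite -(ler_pM2l Pp) -(@ler_pM2l _ 4) //.
apply: (@le_trans _ _ (Y ^+ 2)); last by apply: le_trans h3 _; lra.
have -> : 4 * (P * (r * r' * P')) = (2 * (r * P)) * (2 * (r' * P')) by ring.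
by rewrite expr2; apply: ler_pM => //; rewrite !mulr_ge0.
Qed.

End CheegerStep.

(** * Upper bound for the Cheeger-Steklov constant by disjointly supported test functions *)

Section CheegerSteklovBound.
Variables (R : realType) (M : finType) (V : {set M}).
Variables (L : M -> M -> R) (mu : M -> R).
Hypothesis L_markov : markov_generator L.
Hypothesis L_rev : reversible L mu.
Hypothesis mu_gt0 : forall x, 0 < mu x.

Local Notation w := (edge_mass L mu).

(** Measuring sets by their part in [V] gives [eta'] the same shape as [eta], so one layer-cake
    lemma serves both. *)
Definition trace_measure (x : M) : R := if x \in V then mu x else 0.

(** Twice the usual Dirichlet energy, since each pair of points is counted in both orders. *)
Definition dirichlet_sum (psi : M -> R) : R :=
  \sum_x \sum_y w x y * (psi x - psi y) ^+ 2.

Lemma edge_mass_ge0 x y : 0 <= w x y.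
Proof.
rewrite /edge_mass; case: eqVneq => // xy.
by rewrite mulr_ge0 ?L_markov.1 ?ltW.
Qed.

Lemma edge_massC x y : w x y = w y x.
Proof. by rewrite /edge_mass eq_sym; case: eqP => // _; exact: L_rev. Qed.

Lemma sum_edge_mass x : \sum_y w x y <= gen_norm L * mu x.
Proof.
have -> : \sum_y w x y = - mu x * L x x.
  have := L_markov.2 x; rewrite (bigD1 x) //= => /eqP; rewrite addr_eq0 => /eqP Lxx.
  rewrite (bigD1 x) //= {1}/edge_mass eqxx add0r Lxx mulrNN mulr_sumr.
  by apply: eq_bigr => y yx; rewrite /edge_mass eq_sym (negbTE yx).
rewrite mulrC mulrN -mulNr ler_pM2r //.
apply: (@le_trans _ _ `|L x x|); first by rewrite -normrN ler_norm.
by rewrite /gen_norm; apply: (le_bigmax _ (fun x => `|L x x|)).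
Qed.

Lemma flow_outE (A : {set M}) :
  flow_out L mu A = \sum_(x in A) \sum_(y in ~: A) w x y.
Proof.
rewrite /flow_out /edge_boundary pair_big /=.
by apply: eq_bigl => -[x y]; rewrite finset.in_setX.
Qed.

Lemma flow_out_ge0 (A : {set M}) : 0 <= flow_out L mu A.
Proof. by apply: sumr_ge0 => e _; exact: edge_mass_ge0. Qed.

Lemma set_mass_gt0 (A : {set M}) : A != finset.set0 -> 0 < set_mass mu A.
Proof.
move=> /set0Pn[a aA]; rewrite /set_mass (bigD1 a) //=.
by rewrite ltr_wpDr // sumr_ge0 // => x _; rewrite ltW.
Qed.

Lemma trace_measure_ge0 x : 0 <= trace_measure x.
Proof. by rewrite /trace_measure; case: ifP => // _; rewrite ltW. Qed.

Lemma set_massIV (A : {set M}) :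
  set_mass mu (A :&: V) = \sum_(x in A) trace_measure x.
Proof.
rewrite /set_mass big_mkcond [RHS]big_mkcond; apply: eq_bigr => x _.
by rewrite inE /trace_measure; case: (x \in A).
Qed.

(** [A] itself competes in the minimum, so [rho] is a real number and can serve as the constant of
    the layer-cake bound. *)
Lemma rho_fin (A : {set M}) : A != finset.set0 ->
  exists r, [/\ 0 <= r, rho L mu A = r%:E &
    forall B : {set M}, B != finset.set0 -> B \subset A ->
     r * \sum_(x in B) mu x <= \sum_(x in B) \sum_(y in ~: B) w x y].
Proof.
move=> A0.
have r0 : (0 <= rho L mu A)%E.
  apply: le_bigmin => // B /andP[B0 _].
  by rewrite lee_fin divr_ge0 ?flow_out_ge0 // ltW ?set_mass_gt0.
have rle B : B != finset.set0 -> B \subset A -> (rho L mu A <= Defs.eta L mu B)%E.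
  by move=> B0 BA; apply: bigmin_le_cond; rewrite B0.
have := rle A A0 (subxx A); case E : (rho L mu A) r0 rle => [r| |] // r0 rle _.
exists r; split => // B B0 BA.
rewrite -flow_outE; have := rle B B0 BA; rewrite lee_fin.
by rewrite ler_pdivlMr // set_mass_gt0.
Qed.

Lemma rho'_fin (A : {set M}) : A :&: V != finset.set0 ->
  exists r, [/\ 0 <= r, rho' V L mu A = r%:E &
    forall B : {set M}, B != finset.set0 -> B \subset A ->
     r * \sum_(x in B) trace_measure x
       <= \sum_(x in B) \sum_(y in ~: B) w x y].
Proof.
move=> AV0.
have A0 : A != finset.set0.
  by apply: contra_neq AV0 => ->; rewrite finset.set0I.
have r0 : (0 <= rho' V L mu A)%E.
  apply: le_bigmin => // B /andP[B0 _]; rewrite /eta'; case: ifPn => // BV.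
  by rewrite lee_fin divr_ge0 ?flow_out_ge0 // ltW ?set_mass_gt0.
have rle B : B != finset.set0 -> B \subset A -> (rho' V L mu A <= eta' V L mu B)%E.
  by move=> B0 BA; apply: bigmin_le_cond; rewrite B0.
have := rle A A0 (subxx A); rewrite /eta' (negbTE AV0).
case E : (rho' V L mu A) r0 rle => [r| |] // r0 rle _.
exists r; split => // B B0 BA.
rewrite -flow_outE -set_massIV; have := rle B B0 BA; rewrite /eta'.
(* If [B] misses [V], then [eta'] is infinite and gives no bound, but the trace mass of [B] is 0. *)
case: ifPn => [/eqP -> _|BV].
  by rewrite /set_mass big_set0 mulr0 flow_out_ge0.
by rewrite lee_fin ler_pdivlMr // set_mass_gt0.
Qed.

(** The supports of the [psi l] are the competing [k]-tuple. Positive trace mass makes each support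
    meet [V], hence [rho'] finite there. *)
Lemma cheeger_steklov_le k (psi : 'I_k -> M -> R) (q : R) :
  (forall l x, 0 <= psi l x) ->
  (forall l m x, l != m -> psi l x = 0 \/ psi m x = 0) ->
  (forall l, 0 < \sum_x trace_measure x * psi l x ^+ 2) ->
  (forall l, gen_norm L * dirichlet_sum (psi l) <=
     q * \sum_x trace_measure x * psi l x ^+ 2) ->
  (cheeger_steklov V L mu k <= q%:E)%E.
Proof.
move=> psi0 psiD psiV psiq.
pose A := [ffun l : 'I_k => [set x | psi l x != 0]].
have AV l : A l :&: V != finset.set0.
  apply/negP => /eqP AV0; have := psiV l; rewrite big1 ?ltxx // => x _.
  rewrite /trace_measure; case: ifP => xV; last by rewrite mul0r.
  move/finset.setP: AV0 => /(_ x); rewrite ffunE !inE xV andbT => /negbFE/eqP ->.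
  by rewrite expr0n mulr0.
have A0 l : A l != finset.set0.
  by apply: contra_neq (AV l) => ->; rewrite finset.set0I.
apply: (@bigmin_inf _ _ _ _ A).
  apply/andP; split; first by apply/forallP.
  apply/forallP => l; apply/forallP => m; apply/implyP => lm.
  rewrite disjoint_subset; apply/fintype.subsetP => x; rewrite !ffunE !inE.
  by case: (psiD l m x lm) => ->; rewrite eqxx.
apply: bigmax_le => [|l _]; first by rewrite leNye.
have [r [r0 -> hr]] := rho_fin (A0 l).
have [r' [r'0 -> hr']] := rho'_fin (AV l).
rewrite -EFinM lee_fin -(ler_pM2r (psiV l)); apply: le_trans (psiq l).
apply: (cheeger_product_le edge_mass_ge0 edge_massC mu_gt0 sum_edge_mass
  trace_measure_ge0 r0 r'0 hr hr' (psi0 l)) => x.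
by rewrite ffunE inE negbK => /eqP.
Qed.

End CheegerSteklovBound.

(** * Localization *)

Section Staircase.
Variables (R : realType).

Definition clamp (v : R) : R := Num.min (Num.max v 0) 1.

Lemma clamp_eq0 v : v <= 0 -> clamp v = 0.
Proof. by move=> v0; rewrite /clamp max_r // min_l // ler01. Qed.

Lemma clamp_eq1 v : 1 <= v -> clamp v = 1.
Proof. by move=> v1; rewrite /clamp max_l ?min_r //; lra. Qed.

Lemma clamp_id v : 0 <= v <= 1 -> clamp v = v.
Proof. by move=> /andP[v0 v1]; rewrite /clamp max_l ?min_l. Qed.

Lemma le_clamp v v' : v <= v' -> clamp v <= clamp v'.
Proof.
move=> h; have [v0|v0] := lerP v 0.
  rewrite clamp_eq0 //; have [v'0|v'0] := lerP v' 0; first by rewrite clamp_eq0.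
  have [v'1|v'1] := lerP v' 1; first by rewrite clamp_id; lra.
  by rewrite clamp_eq1; lra.
have [v1|v1] := lerP 1 v; first by rewrite !clamp_eq1; lra.
rewrite (@clamp_id v); last by lra.
have [v'1|v'1] := lerP 1 v'; first by rewrite clamp_eq1; lra.
by rewrite clamp_id; lra.
Qed.

(** Each term is the length of the part of the slab [[m, m + 1]] lying below [u]. *)
Lemma sum_clamp (K : nat) (u : R) : 0 <= u <= K%:R ->
  \sum_(m < K) clamp (u - m%:R) = u.
Proof.
elim: K => [|K IH]; first by rewrite big_ord0 => h; lra.
rewrite -natr1 => /andP[u0 uK]; rewrite big_ord_recr /=.
have [h|h] := lerP u K%:R.
  by rewrite IH ?u0 // clamp_eq0 ?addr0 //; lra.
rewrite (eq_bigr (fun=> 1)) => [|m _].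
  by rewrite sumr_const card_ord clamp_id; lra.
have : (m.+1)%:R <= K%:R :> R by rewrite ler_nat.
by rewrite -natr1 => mK; rewrite clamp_eq1; lra.
Qed.

Variables N K : nat.
Hypothesis N_gt0 : (0 < N)%N.

(* Steps up by 1 across each unit slab [m, m + 1] with m = t modulo N and is
   constant elsewhere, so that the staircases with t < N sum to the identity. *)
Definition staircase (t : nat) (u : R) : R :=
  \sum_(m < K | (m %% N)%N == t) clamp (u - m%:R).

Lemma clamp_ge0 v : 0 <= clamp v.
Proof.
have [h|h] := lerP v 0; first by rewrite clamp_eq0.
by have := le_clamp (ltW h); rewrite clamp_eq0.
Qed.

Lemma le_staircase t u u' : u <= u' -> staircase t u <= staircase t u'.
Proof. by move=> h; apply: ler_sum => m _; rewrite le_clamp // lerB. Qed.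

Lemma staircase_ge0 t u : 0 <= staircase t u.
Proof. by apply: sumr_ge0 => m _; exact: clamp_ge0. Qed.

Lemma sum_staircase u : 0 <= u <= K%:R -> \sum_(t < N) staircase t u = u.
Proof.
move=> hu; rewrite -[RHS](sum_clamp hu) /staircase.
under eq_bigr do rewrite big_mkcond.
rewrite exchange_big; apply: eq_bigr => m _.
rewrite -big_mkcond (big_pred1 (Ordinal (ltn_pmod m N_gt0))) // => t.
Qed.

(** The increments have one sign and add up to [u - u'], so their squares add up to at most its
    square. Hence all [N] grids together cost no more than one squared increment. *)
Lemma sum_sqr_staircase u u' : 0 <= u <= K%:R -> 0 <= u' <= K%:R ->
  \sum_(t < N) (staircase t u - staircase t u') ^+ 2 <= (u - u') ^+ 2.
Proof.
wlog uu' : u u' / u' <= u.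
  move=> H hu hu'; have [h|h] := lerP u' u; first exact: H.
  have := H u' u (ltW h) hu' hu; rewrite -sqrrN opprB; apply: le_trans.
  by apply: ler_sum => t _; rewrite -sqrrN opprB.
move=> hu hu'.
have a0 (t : 'I_N) : 0 <= staircase t u - staircase t u'.
  by rewrite subr_ge0 le_staircase.
have E : \sum_(t < N) (staircase t u - staircase t u') = u - u'.
  by rewrite sumrB !sum_staircase.
rewrite -E expr2 mulr_suml; apply: ler_sum => t _.
rewrite expr2 ler_wpM2l // (bigD1 t) //= lerDl sumr_ge0 // => s _.
Qed.

(** An interval of length [N + 1] contains a full slab in which the staircase [t] rises. *)
Lemma staircase_gap t u u' : (t < N)%N -> 0 <= u -> u + N%:R + 1 <= u' ->
  u' <= K%:R -> staircase t u + 1 <= staircase t u'.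
Proof.
move=> tN u0 uu' u'K.
set c := (Num.truncn u).+1.
have [cu uc] : c%:R <= u + 1 /\ u <= c%:R.
  have /andP[h1 h2] := truncn_itv u0; rewrite /c; split; last exact: ltW.
  by rewrite -natr1 lerD2r.
(* The least integer from [c] on that is congruent to [t] modulo [N]. *)
pose m := (c + (t + (N - c %% N)) %% N)%N.
have mt : (m %% N)%N = t.
  rewrite /m modnDmr.
  have -> : (c + (t + (N - c %% N)) = (c %/ N).+1 * N + t)%N.
    have := ltn_pmod c N_gt0; have := divn_eq c N; rewrite mulSn.
    by move: (c %/ N * N)%N (c %% N)%N => z r; lia.
  by rewrite modnMDl modn_small.
have mcN : (m < c + N)%N by rewrite ltn_add2l ltn_pmod.
have cm : (c <= m)%N by rewrite leq_addr.
have mu' : m.+1%:R <= u'.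
  have : m.+1%:R <= (c + N)%:R :> R by rewrite ler_nat.
  by rewrite natrD; lra.
have mK : (m < K)%N.
  by rewrite -(ltr_nat R) (lt_le_trans _ u'K) // (lt_le_trans _ mu') // ltr_nat.
rewrite /staircase (bigD1 (Ordinal mK)) ?mt //= [leRHS](bigD1 (Ordinal mK)) ?mt //=.
have um : u <= m%:R by apply: (le_trans uc); rewrite ler_nat.
rewrite clamp_eq0; last by rewrite subr_le0.
rewrite clamp_eq1; last by move: mu'; rewrite -natr1; lra.
rewrite add0r [leLHS]addrC lerD2l; apply: ler_sum => i _; rewrite le_clamp // lerB //.
by apply: le_trans uu'; rewrite -addrA lerDl addr_ge0.
Qed.

(** Outside the rising slabs of [t] every clamp is 0 or 1; the tent is then 1, so nothing is
    damped. *)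
Lemma staircase_nat t u : 0 <= u -> (Num.truncn u %% N)%N != t ->
  exists n : nat, staircase t u = n%:R.
Proof.
move=> u0 ut; exists (\sum_(m < K | (m %% N)%N == t) (m < Num.truncn u))%N.
rewrite natr_sum; apply: eq_bigr => m /eqP mt.
have /andP[h1 h2] := truncn_itv u0.
have [mu|mu|mu] := ltngtP m (Num.truncn u); last by rewrite -mu mt eqxx in ut.
  rewrite clamp_eq1 // lerBrDr addrC natr1 (le_trans _ h1) // ler_nat //.
by rewrite clamp_eq0 // subr_le0 (le_trans (ltW h2)) // ler_nat.
Qed.

End Staircase.

(** * Distance to the walls in one coordinate *)

Section Tent.
Variables (R : realType).

(* Grid walls sit at half-integral heights of the staircases, in the middle of
   the slabs; [tent] is twice the distance to the nearest wall height. *)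
Definition cell (g : R) : nat := Num.truncn (g + 2^-1).

Definition tent (g : R) : R := 1 - 2 * `|g - (cell g)%:R|.

Lemma cell_itv g : 0 <= g -> (cell g)%:R <= g + 2^-1 < (cell g)%:R + 1.
Proof. by move=> g0; rewrite natr1 truncn_itv // addr_ge0. Qed.

Lemma tent_itv g : 0 <= g -> 0 <= tent g <= 1.
Proof.
move=> /cell_itv; rewrite /tent; move: (cell g)%:R => c h.
by case: (lerP c g) => k; apply/andP; split; lra.
Qed.

Lemma tent_nat (n : nat) : tent n%:R = 1.
Proof.
rewrite /tent /cell (@truncn_def _ _ n) ?subrr ?normr0 ?mulr0 ?subr0 //.
by rewrite -[n.+1%:R]natr1; apply/andP; split; lra.
Qed.

Lemma tent_lip g g' : cell g = cell g' -> `|tent g - tent g'| <= 2 * `|g - g'|.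
Proof.
rewrite /tent => ->; move: (cell g')%:R => c.
have := lerB_dist (g' - c) (g - c); have := lerB_dist (g - c) (g' - c).
have -> : g - c - (g' - c) = g - g' by ring.
have -> : g' - c - (g - c) = - (g - g') by ring.
by rewrite normrN => h1 h2; rewrite ler_norml; apply/andP; split; lra.
Qed.

(** A wall height separates [g] from [g'], so the nearest one is no farther from [g] than [g']
    is. *)
Lemma tent_cross g g' : 0 <= g -> 0 <= g' -> cell g != cell g' ->
  tent g <= 2 * `|g - g'|.
Proof.
move=> /cell_itv h /cell_itv h'; rewrite neq_ltn /tent => /orP[] lt.
  have : (cell g).+1%:R <= (cell g')%:R :> R by rewrite ler_nat.
  rewrite -natr1; move: h h'; move: (cell g)%:R (cell g')%:R => c c' h h' lt'.
  rewrite [X in _ <= 2 * X]ler0_norm; last by lra.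
  by have := ler_norm (g - c); lra.
have : (cell g').+1%:R <= (cell g)%:R :> R by rewrite ler_nat.
rewrite -natr1; move: h h'; move: (cell g)%:R (cell g')%:R => c c' h h' lt'.
rewrite [X in _ <= 2 * X]ger0_norm; last by lra.
by have := ler_norm (c - g); rewrite distrC; lra.
Qed.

Lemma cell_dist g g' : 0 <= g -> 0 <= g' -> cell g = cell g' -> `|g - g'| < 1.
Proof.
move=> /cell_itv h /cell_itv h' E; move: h h'; rewrite E; move: (cell g')%:R => c.
by case: (lerP g' g) => k; lra.
Qed.

End Tent.

(** * Cutoffs near the walls of a grid of cubes *)

Section Cutoff.
Variables (R : realType) (M : finType) (d N K : nat) (u : M -> 'I_d -> R).
Hypothesis N_gt0 : (0 < N)%N.
Hypothesis u_itv : forall x i, 0 <= u x i <= K%:R.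

Local Notation G t x i := (staircase N K t (u x i)).

Definition cutoff (t : nat) (x : M) : R := \big[Num.min/1]_(i < d) tent (G t x i).

(** A cube is represented by the points it contains, so that the cubes are indexed by the finite
    type [{set M}]. *)
Definition cube (t : nat) (x : M) : {set M} :=
  [set y | [forall i, cell (G t x i) == cell (G t y i)]].

Lemma cubeP t x y :
  reflect (forall i, cell (G t x i) = cell (G t y i)) (cube t x == cube t y).
Proof.
apply: (iffP eqP) => [E i|E].
  have : y \in cube t y by rewrite inE; apply/forallP => j.
  by rewrite -E inE => /forallP/(_ i)/eqP.
by apply/finset.setP => z; rewrite !inE; apply: eq_forallb => i; rewrite E.
Qed.

Lemma cutoff_le t x i : cutoff t x <= tent (G t x i).
Proof. exact: bigmin_le. Qed.

Lemma cutoff_itv t x : 0 <= cutoff t x <= 1.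
Proof.
apply/andP; split; last exact: bigmin_le_id.
apply: le_bigmin => // i _.
by have /andP[] := tent_itv (staircase_ge0 N K t (u x i)).
Qed.

Lemma cutoff_lip t x y c : (forall i, `|G t x i - G t y i| <= c) -> 0 <= c ->
  cube t x = cube t y -> cutoff t x - cutoff t y <= 2 * c.
Proof.
move=> hc c0 /eqP/cubeP E; rewrite lerBlDl -lerBlDr; apply: le_bigmin => [|i _].
  by have := cutoff_itv t x; lra.
rewrite lerBlDr; apply: le_trans (cutoff_le t x i) _; rewrite -lerBlDl.
apply: le_trans (ler_norm _) _; apply: le_trans (tent_lip (E i)) _.
by rewrite ler_pM2l.
Qed.

Lemma cutoff_cross t x y c : (forall i, `|G t x i - G t y i| <= c) ->
  cube t x != cube t y -> cutoff t x <= 2 * c.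
Proof.
move=> hc nE.
have /existsP[i ni] : [exists i, cell (G t x i) != cell (G t y i)].
  rewrite -negb_forall; apply: contra nE => /forallP H.
  by apply/cubeP => i; apply/eqP.
apply: le_trans (cutoff_le t x i) _.
apply: le_trans (tent_cross _ _ ni) _; [exact: staircase_ge0..|].
by rewrite ler_pM2l.
Qed.

(** Within a cube the cutoff is 2-Lipschitz for the sup norm. Between distinct cubes a wall
    intervenes and both values are already small. Hence keeping only the cubes in [P] costs nothing
    extra. *)
Lemma sqr_cutoff_diff_le (P : pred {set M}) t x y :
  ((if P (cube t x) then cutoff t x else 0) -
   (if P (cube t y) then cutoff t y else 0)) ^+ 2 <=
  4 * \sum_i (G t x i - G t y i) ^+ 2.
Proof.
set S := \sum_i _.
have S0 : 0 <= S by apply: sumr_ge0 => i _; rewrite sqr_ge0.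
have hc i : `|G t x i - G t y i| <= Num.sqrt S.
  rewrite -sqrtr_sqr ler_wsqrtr // /S (bigD1 i) //= lerDl sumr_ge0 // => j _.
  exact: sqr_ge0.
have hc' i : `|G t y i - G t x i| <= Num.sqrt S by rewrite distrC.
have s0 : 0 <= Num.sqrt S by rewrite sqrtr_ge0.
have -> : 4 * S = (2 * Num.sqrt S) ^+ 2 by rewrite exprMn sqr_sqrtr //; ring.
rewrite -[leLHS]real_normK ?num_real // ler_sqr ?nnegrE ?mulr_ge0 //.
have /andP[x0 x1] := cutoff_itv t x; have /andP[y0 y1] := cutoff_itv t y.
have [E|nE] := eqVneq (cube t x) (cube t y).
  rewrite E; case: ifP => _; last by rewrite subrr normr0 mulr_ge0.
  rewrite ler_norml; apply/andP; split; last exact: cutoff_lip.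
  by rewrite lerNl opprB; apply: cutoff_lip.
have cx := cutoff_cross hc nE.
have cy : cutoff t y <= 2 * Num.sqrt S by apply: cutoff_cross hc' _; rewrite eq_sym.
by rewrite ler_norml; apply/andP; split; case: ifP => _; case: ifP => _; lra.
Qed.

(** For each coordinate exactly one residue [t] rises in the slab containing [u x i], so at most [d]
    of the cutoffs differ from 1 at [x]. *)
Lemma sum_cutoff_loss x : \sum_(t < N) (1 - cutoff t x ^+ 2) <= d%:R.
Proof.
apply: (@le_trans _ _ (\sum_(t < N) \sum_(i < d)
   ((Num.truncn (u x i) %% N)%N == t)%:R)); last first.
  rewrite exchange_big /= -[X in X%:R]card_ord -sumr_const.
  apply: ler_sum => i _.
  rewrite (bigD1 (Ordinal (ltn_pmod (Num.truncn (u x i)) N_gt0))) //= eqxx.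
  rewrite big1 ?addr0 // => s /negbTE ns.
  by rewrite -[(_ == _)]/(Ordinal (ltn_pmod (Num.truncn (u x i)) N_gt0) == s) eq_sym ns.
apply: ler_sum => t _.
have /andP[c0 c1] := cutoff_itv t x.
have [/existsP[i it]|/existsPn H] :=
    boolP [exists i, (Num.truncn (u x i) %% N)%N == t].
  rewrite (bigD1 i) //= it; apply: (@le_trans _ _ 1); last first.
    by rewrite lerDl sumr_ge0.
  by rewrite gerBl sqr_ge0.
rewrite big1 => [|i _]; last by rewrite (negbTE (H i)).
suff -> : cutoff t x = 1 by rewrite expr1n subrr.
apply/eqP; rewrite eq_le c1 /=; apply: le_bigmin => // i _.
have /andP[u0 _] := u_itv x i.
by have [n ->] := staircase_nat K u0 (H i); rewrite tent_nat.
Qed.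

(** A wider separation would make the staircase grow by at least 1, but a cell is a half-open
    interval of length 1. *)
Lemma cube_diameter t x y i : (t < N)%N -> cube t x = cube t y ->
  `|u x i - u y i| <= N%:R + 1.
Proof.
move=> tN E.
wlog le_yx : x y E / u y i <= u x i.
  move=> H; case/orP: (le_total (u y i) (u x i)) => h; first exact: H.
  by rewrite distrC; exact: H.
rewrite ger0_norm ?subr_ge0 // leNgt; apply/negP => far.
have /andP[y0 _] := u_itv y i; have /andP[_ xK] := u_itv x i.
have : staircase N K t (u y i) + 1 <= staircase N K t (u x i).
  by apply: staircase_gap => //; lra.
have /eqP/cubeP/(_ i) Ei := E.
have := cell_dist (staircase_ge0 N K t _) (staircase_ge0 N K t _) Ei.
by rewrite ltr_norml => /andP[_ h]; lra.
Qed.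

End Cutoff.

(** * Greedy merging of cubes and choice of a translate *)

Section Grouping.
Variables (R : realType) (T : finType) (m : T -> R) (b : R).
Hypothesis m_ge0 : forall c, 0 <= m c.
Hypothesis b_ge1 : 1 <= b.
Hypothesis m_le : forall c, m c <= b.

(** Take a smallest subset of mass at least 1/2. If it has an element of mass at least 1/2, that
    element suffices; otherwise deleting one element leaves less than 1/2, so the total is below
    1. *)
Lemma exists_light_group (U : {set T}) : 2^-1 <= \sum_(c in U) m c ->
  exists2 B : {set T}, B \subset U & 2^-1 <= \sum_(c in B) m c <= b.
Proof.
move=> hU.
have PU : (U \subset U) && (2^-1 <= \sum_(c in U) m c) by rewrite subxx.
case: (@arg_minnP _ U (fun B : {set T} => (B \subset U) && (2^-1 <= \sum_(c in B) m c))
  (fun B => #|B|) PU) => B /andP[BU hB] minB.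
have [/existsP[c /andP[cB hc]]|/existsPn H] :=
    boolP [exists c, (c \in B) && (2^-1 <= m c)].
  exists [set c]; last by rewrite big_set1 hc m_le.
  by rewrite finset.sub1set (fintype.subsetP BU).
exists B => //; rewrite hB /=.
have [B0|/set0Pn[c cB]] := eqVneq B finset.set0.
  by move: hB; rewrite B0 big_set0; lra.
have : m c < 2^-1 by have := H c; rewrite cB -ltNge.
have : \sum_(x in B :\ c) m x < 2^-1.
  rewrite ltNge; apply/negP => h.
  have := minB (B :\ c); rewrite h (fintype.subset_trans (subD1set _ _) BU) => /(_ isT).
  by rewrite (cardsD1 c B) cB add1n ltnn.
have -> : \sum_(x in B) m x = m c + \sum_(x in B :\ c) m x by exact: big_setD1.
by have := b_ge1; lra.
Qed.

(** Each light group removed costs at most [b], and what remains after [j] removals is one more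
    group. The groups are the level sets of [g] in [U], numbered from 0 to [j]. *)
Lemma exists_heavy_groups (j : nat) (U : {set T}) :
  j%:R * b + 2^-1 <= \sum_(c in U) m c ->
  exists g : T -> nat, forall l, (l <= j)%N ->
    2^-1 <= \sum_(c in U | g c == l) m c.
Proof.
elim: j U => [|j IH] U hU.
  exists (fun=> 0%N) => l; rewrite leqn0 => /eqP ->.
  by under eq_bigl do rewrite andbT; lra.
have bge0 : 0 <= b by have := b_ge1; lra.
have [|B BU /andP[hB Bb]] := @exists_light_group U.
  by apply: le_trans hU; rewrite lerDr mulr_ge0.
have UDB : \sum_(c in U) m c = \sum_(c in B) m c + \sum_(c in U :\: B) m c.
  by rewrite (big_setID B) /= (finset.setIidPr BU).
have [|g hg] := IH (U :\: B).
  by move: hU; rewrite UDB -natr1; lra.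
exists (fun c => if c \in B then j.+1 else g c) => l.
rewrite leq_eqVlt => /orP[/eqP ->|lj].
  apply: le_trans hB _; rewrite [leRHS](bigID (mem B)) /=.
  rewrite [X in _ <= X + _](eq_bigl (mem B)) ?lerDl ?sumr_ge0 // => c /=.
  by case: ifPn => cB; rewrite ?andbF // (fintype.subsetP BU) ?eqxx.
apply: le_trans (hg l lj) _; rewrite le_eqVlt; apply/orP; left; apply/eqP.
apply: eq_bigl => c; rewrite inE; case: ifPn => //= cB.
by rewrite gtn_eqF ?andbF.
Qed.

End Grouping.

(** The average of [a t / A + b t / B] is at most [2 / N], so some [t] is good for both sums. When
    [B = 0] every [b t] vanishes and only [a] is averaged. *)
Lemma sum_le_exists2 (R : realFieldType) (N : nat) (a b : 'I_N -> R) (A B : R) :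
  (0 < N)%N -> 0 < A -> (forall t, 0 <= b t) ->
  (forall t, 0 <= a t) ->
  \sum_t a t <= A -> \sum_t b t <= B ->
  exists t, a t <= 2 * A / N%:R /\ b t <= 2 * B / N%:R.
Proof.
move=> N0 A0 b0 a0 hA hB.
have Np : 0 < N%:R :> R by rewrite ltr0n.
have B0 : 0 <= B by apply: le_trans hB; apply: sumr_ge0.
have [Bz|Bn] := eqVneq B 0.
  have [t _ ht] : exists2 t : 'I_N, true & a t <= A / N%:R.
    apply/exists_inP; apply: contraT => /exists_inPn H.
    suff : N%:R * (A / N%:R) < \sum_t a t by rewrite mulrCA divff ?gt_eqF // mulr1; lra.
    rewrite -[X in X%:R]card_ord mulr_natl -sumr_const; apply: ltr_sum => [|t _].
      by apply/hasP; exists (Ordinal N0); rewrite ?mem_index_enum.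
    by rewrite ltNge card_ord; exact: (H t isT).
  exists t; split; first by apply: le_trans ht _; rewrite ler_pM2r ?invr_gt0 //; lra.
  rewrite Bz mulr0 mul0r -Bz; apply: le_trans hB.
  by rewrite (bigD1 t) //= lerDl sumr_ge0.
have Bp : 0 < B by rewrite lt_def Bn.
have [t ht] : exists t : 'I_N, a t / A + b t / B <= 2 / N%:R.
  apply/existsP; apply: contraT => /existsPn H.
  suff : N%:R * (2 / N%:R) < \sum_t (a t / A + b t / B).
    rewrite mulrCA divff ?gt_eqF // mulr1 big_split /= -!mulr_suml.
    have : (\sum_t a t) / A <= 1 by rewrite ler_pdivrMr ?mul1r.
    have : (\sum_t b t) / B <= 1 by rewrite ler_pdivrMr ?mul1r.
    by lra.
  rewrite -[X in X%:R]card_ord mulr_natl -sumr_const; apply: ltr_sum => [|t _].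
    by apply/hasP; exists (Ordinal N0); rewrite ?mem_index_enum.
  by have := H t; rewrite -ltNge card_ord.
have at0 : 0 <= a t / A by rewrite divr_ge0 // ltW.
have bt0 : 0 <= b t / B by rewrite divr_ge0 // ltW.
exists t; split.
  by rewrite mulrAC -ler_pdivrMr //; lra.
by rewrite mulrAC -ler_pdivrMr //; lra.
Qed.

(** * Polar coordinates in Euclidean space *)

Section Radial.
Variables (R : realType) (d : nat).
Implicit Types a b : 'I_d -> R.

Definition sqnorm a : R := \sum_i a i ^+ 2.
Definition norm a : R := Num.sqrt (sqnorm a).
(** Since the inverse of 0 is 0, the zero vector has direction 0, and the factorization of [a] as
    norm times direction has no exception. *)
Definition direction a (i : 'I_d) : R := a i / norm a.
Definition sqdist a b : R := \sum_i (a i - b i) ^+ 2.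

Lemma sqnorm_ge0 a : 0 <= sqnorm a.
Proof. by apply: sumr_ge0 => i _; rewrite sqr_ge0. Qed.

Lemma norm_ge0 a : 0 <= norm a.
Proof. exact: sqrtr_ge0. Qed.

Lemma sqr_norm a : norm a ^+ 2 = sqnorm a.
Proof. by rewrite sqr_sqrtr // sqnorm_ge0. Qed.

Lemma coord_le_norm a i : `|a i| <= norm a.
Proof.
rewrite -sqrtr_sqr ler_wsqrtr // /sqnorm (bigD1 i) //= lerDl sumr_ge0 // => j _.
exact: sqr_ge0.
Qed.

Lemma norm_direction a i : norm a * direction a i = a i.
Proof.
rewrite /direction; have [a0|a0] := eqVneq (norm a) 0; last by rewrite mulrC divfK.
have := coord_le_norm a i; rewrite a0 normr_le0 => /eqP ->.
by rewrite mul0r.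
Qed.

Lemma direction_itv a i : -1 <= direction a i <= 1.
Proof.
rewrite -ler_norml /direction normrM normfV (ger0_norm (norm_ge0 a)).
have [a0|a0] := eqVneq (norm a) 0; first by rewrite a0 invr0 mulr0 ler01.
by rewrite ler_pdivrMr ?mul1r ?coord_le_norm // lt_def a0 norm_ge0.
Qed.

Lemma sqnorm_direction a : norm a != 0 -> sqnorm (direction a) = 1.
Proof.
move=> a0; rewrite /sqnorm /direction.
under eq_bigr do rewrite exprMn.
by rewrite -mulr_suml -/(sqnorm a) -sqr_norm exprVn divff // expf_neq0.
Qed.

Lemma norm_sqnorm_direction a : norm a * sqnorm (direction a) = norm a.
Proof.
have [->|a0] := eqVneq (norm a) 0; first by rewrite mul0r.
by rewrite sqnorm_direction // mulr1.
Qed.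

Lemma sqdistE a b : sqdist a b = sqnorm a + sqnorm b - 2 * \sum_i a i * b i.
Proof.
rewrite /sqdist /sqnorm mulr_sumr -big_split -sumrB /=.
by apply: eq_bigr => i _; ring.
Qed.

Lemma sqdist_ge0 a b : 0 <= sqdist a b.
Proof. by apply: sumr_ge0 => i _; rewrite sqr_ge0. Qed.

(** The law of cosines. It splits the energy into a radial part and an angular part weighted by
    [norm a * norm b], the weight that reappears in [sqr_scaled_diff_le]. *)
Lemma sqdist_polar a b :
  sqdist a b = (norm a - norm b) ^+ 2 +
               norm a * norm b * sqdist (direction a) (direction b).
Proof.
rewrite !sqdistE.
have -> : \sum_i a i * b i =
    norm a * norm b * \sum_i direction a i * direction b i.
  rewrite mulr_sumr; apply: eq_bigr => i _.
  by rewrite -{1}(norm_direction a) -{1}(norm_direction b); ring.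
have := norm_sqnorm_direction a; have := norm_sqnorm_direction b.
rewrite -!sqr_norm; move: (norm a) (norm b) => x y.
move: (norm (direction a)) (norm (direction b)) (\sum_i _) => p q s hq hp.
have -> : x * y * (p ^+ 2 + q ^+ 2 - 2 * s) =
  y * (x * p ^+ 2) + x * (y * q ^+ 2) - 2 * (x * y * s) by ring.
by rewrite hp hq; ring.
Qed.

(** For [x <= y], split [x s - y t = x (s - t) + (x - y) t], so that the smaller factor multiplies
    [s - t] and [x^2 <= x y]. *)
Lemma sqr_scaled_diff_le (x y s t : R) : 0 <= x -> 0 <= y -> 0 <= s <= 1 ->
  0 <= t <= 1 ->
  (x * s - y * t) ^+ 2 <= 2 * (x - y) ^+ 2 + 2 * (x * y) * (s - t) ^+ 2.
Proof.
wlog xy : x y s t / x <= y.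
  move=> H x0 y0 hs ht; case/orP: (le_total x y) => h; first exact: H.
  have := H _ _ _ _ h y0 x0 ht hs; congr (_ <= _); ring.
move=> x0 y0 /andP[s0 s1] /andP[t0 t1].
have -> : x * s - y * t = x * (s - t) + (x - y) * t by ring.
have le1 : x ^+ 2 * (s - t) ^+ 2 <= x * y * (s - t) ^+ 2.
  by rewrite ler_wpM2r ?sqr_ge0 // expr2 ler_wpM2l.
have le2 : (x - y) ^+ 2 * t ^+ 2 <= (x - y) ^+ 2.
  by rewrite ler_piMr ?sqr_ge0 // expr_le1.
have := sqr_ge0 (x * (s - t) - (x - y) * t).
have -> : (x * (s - t) - (x - y) * t) ^+ 2 =
  2 * (x ^+ 2 * (s - t) ^+ 2) + 2 * ((x - y) ^+ 2 * t ^+ 2) -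
  (x * (s - t) + (x - y) * t) ^+ 2 by ring.
by lra.
Qed.

End Radial.

(** * Spreading of mass under isotropy *)

Section Spreading.
Variables (R : realType) (M : finType) (d : nat) (nu : M -> R).
Variable F : M -> 'I_d -> R.
Hypothesis nu_ge0 : forall x, 0 <= nu x.
Hypothesis iso : forall a : 'I_d -> R,
  \sum_x nu x * (\sum_i a i * F x i) ^+ 2 <= sqnorm a.

(* All of F on a set of small angular diameter is nearly parallel to a single
   unit vector, whose second moment is at most 1. *)
Lemma mass_small_diameter (P : pred M) (tau : R) : 0 <= tau <= 2^-1 ->
  (forall x y, P x -> P y ->
     sqdist (direction (F x)) (direction (F y)) <= tau) ->
  \sum_(x | P x) nu x * sqnorm (F x) <= 1 + 2 * tau.
Proof.
move=> /andP[tau0 tau1] diam.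
have [/existsP[x /andP[Px x0]]|/existsPn H] :=
    boolP [exists x, P x && (norm (F x) != 0)]; last first.
  rewrite big1 => [|x Px]; first by rewrite addr_ge0 // mulr_ge0.
  have := H x; rewrite Px /= negbK => /eqP n0.
  by rewrite -sqr_norm n0 expr0n mulr0.
suff h : (1 - tau) * \sum_(y | P y) nu y * sqnorm (F y) <= 1.
  have tau_lt1 : 0 < 1 - tau by lra.
  rewrite -(ler_pM2l tau_lt1); apply: le_trans h _.
  have -> : (1 - tau) * (1 + 2 * tau) = 1 + tau * (1 - 2 * tau) by ring.
  by rewrite lerDl mulr_ge0 //; lra.
(* Isotropy is tested on the unit vector [direction (F x)]; every [F y] in [P] has most of its
   length along it. *)
apply: le_trans (le_trans _ (iso (direction (F x)))) _; last first.
  by rewrite sqnorm_direction.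
rewrite mulr_sumr [leRHS](bigID P) /=.
apply: ler_wpDr.
  by apply: sumr_ge0 => y _; rewrite mulr_ge0 ?sqr_ge0.
apply: ler_sum => y Py; rewrite mulrCA ler_wpM2l //.
have [n0|n0] := eqVneq (norm (F y)) 0.
  by rewrite -sqr_norm n0 expr0n mulr0 sqr_ge0.
have -> : \sum_i direction (F x) i * F y i =
    norm (F y) * \sum_i direction (F x) i * direction (F y) i.
  rewrite mulr_sumr; apply: eq_bigr => i _.
  by rewrite -{1}(norm_direction (F y) i); ring.
rewrite exprMn sqr_norm mulrC ler_wpM2l ?sqnorm_ge0 //.
have := diam x y Px Py; rewrite sqdistE !sqnorm_direction //.
move: (\sum_i _) => s hs.
(* The cosine [s] is at least [1 - tau / 2], hence [s^2 >= 1 - tau]. *)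
have : 0 <= (s - (1 - tau / 2)) * (s + (1 - tau / 2)) by rewrite mulr_ge0 //; lra.
have := sqr_ge0 tau; nra.
Qed.

End Spreading.

(** * Construction of the disjointly supported functions *)

Section Localization.
Variables (R : realType) (M : finType) (k : nat).
Variables (w : M -> M -> R) (nu : M -> R) (F : M -> 'I_(k + k) -> R).
Hypothesis k_gt0 : (0 < k)%N.
Hypothesis w_ge0 : forall x y, 0 <= w x y.
Hypothesis nu_ge0 : forall x, 0 <= nu x.
Hypothesis iso : forall a : 'I_(k + k) -> R,
  \sum_x nu x * (\sum_i a i * F x i) ^+ 2 <= sqnorm a.
Hypothesis total : \sum_x nu x * sqnorm (F x) = k%:R.

(* N = 16 k ^ 2 makes the average loss, 2 k ^ 2 / N, at most 1/8; the scale H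
   makes grid cubes, of side (N + 1) / H in the directions, at most
   1 / (4 k) wide, so that their squared diameter is at most 1 / (8 k). *)
Let N : nat := (16 * k ^ 2)%N.
Let H : nat := (128 * k ^ 3)%N.
(** Coordinates of directions lie in [[-1, 1]]; shifted by 1 and scaled by [H] they fill at most
    [[0, 2 H]]. *)
Let K : nat := (2 * H)%N.
Let u x i : R := H%:R * (direction (F x) i + 1).
Let kR : R := k%:R.

Let kR_ge1 : 1 <= kR.
Proof. by rewrite /kR ler1n. Qed.

Let NE : N%:R = 16 * kR ^+ 2 :> R.
Proof. by rewrite /N natrM natrX. Qed.

Let HE : H%:R = 128 * kR ^+ 3 :> R.
Proof. by rewrite /H natrM natrX. Qed.

Let N_gt0 : (0 < N)%N.
Proof. by rewrite /N muln_gt0 expn_gt0 k_gt0. Qed.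

Let u_itv x i : 0 <= u x i <= K%:R.
Proof.
have /andP[h1 h2] := direction_itv (F x) i.
have H0 : 0 <= H%:R :> R by [].
rewrite /u /K natrM [2 * _]mulrC; apply/andP; split; first by rewrite mulr_ge0 //; lra.
by rewrite ler_wpM2l //; lra.
Qed.

Let uB x y i : u x i - u y i = H%:R * (direction (F x) i - direction (F y) i).
Proof. by rewrite /u; ring. Qed.

Let E : R := \sum_x \sum_y w x y * sqdist (F x) (F y).

Let loss t : R := \sum_x nu x * sqnorm (F x) * (1 - cutoff N K u t x ^+ 2).

Let step t x y : R :=
  4 * \sum_i (staircase N K t (u x i) - staircase N K t (u y i)) ^+ 2.

(** Bounds the energy of [norm (F x)] times the cutoff on any union of cubes. It does not depend on
    the union, so [t] can be chosen before the cubes are merged. *)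
Let energy t : R := \sum_x \sum_y w x y *
  (2 * (norm (F x) - norm (F y)) ^+ 2 + 2 * (norm (F x) * norm (F y)) * step t x y).

Let loss_ge0 t : 0 <= loss t.
Proof.
apply: sumr_ge0 => x _; rewrite mulr_ge0 ?mulr_ge0 ?sqnorm_ge0 //.
have /andP[c0 c1] := cutoff_itv N K u t x.
by rewrite subr_ge0 expr_le1.
Qed.

Let step_ge0 t x y : 0 <= step t x y.
Proof. by rewrite mulr_ge0 // sumr_ge0 // => i _; rewrite sqr_ge0. Qed.

Let energy_ge0 t : 0 <= energy t.
Proof.
apply: sumr_ge0 => x _; apply: sumr_ge0 => y _; rewrite mulr_ge0 // addr_ge0 //.
  by rewrite mulr_ge0 ?sqr_ge0.
by rewrite mulr_ge0 ?step_ge0 // !mulr_ge0 ?norm_ge0.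
Qed.

Let sum_loss : \sum_(t < N) loss t <= 2 * kR ^+ 2.
Proof.
rewrite exchange_big /=.
apply: (@le_trans _ _ (\sum_x nu x * sqnorm (F x) * (k + k)%:R)).
  apply: ler_sum => x _; rewrite -mulr_sumr ler_wpM2l ?mulr_ge0 ?sqnorm_ge0 //.
  exact: sum_cutoff_loss.
rewrite -mulr_suml total natrD -/kR; lra.
Qed.

(** The angular parts add up by [sum_sqr_staircase] to at most a multiple of [H^2]; the radial part
    is repeated [N] times, and [2 N <= 8 H^2]. *)
Let sum_energy : \sum_(t < N) energy t <= 8 * H%:R ^+ 2 * E.
Proof.
rewrite exchange_big /= /E mulr_sumr; apply: ler_sum => x _.
rewrite exchange_big /= mulr_sumr; apply: ler_sum => y _.
rewrite -mulr_sumr [leRHS]mulrCA ler_wpM2l // big_split /= sumr_const card_ord.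
rewrite -mulr_sumr.
have hs : \sum_(t < N) step t x y <=
    4 * H%:R ^+ 2 * sqdist (direction (F x)) (direction (F y)).
  rewrite -mulr_sumr -mulrA ler_pM2l // exchange_big /= mulr_sumr.
  apply: ler_sum => i _; apply: le_trans (sum_sqr_staircase N_gt0 (u_itv x i) (u_itv y i)) _.
  by rewrite uB exprMn.
have n0 : 0 <= 2 * (norm (F x) * norm (F y)) by rewrite !mulr_ge0 ?norm_ge0.
rewrite sqdist_polar mulrDr lerD //.
  rewrite -[leLHS]mulr_natl mulrA ler_wpM2r ?sqr_ge0 // NE HE.
  have : kR ^+ 2 <= kR ^+ 6 by rewrite ler_weXn2l.
  have : 1 <= kR ^+ 2 by rewrite exprn_ege1.
  have -> : 8 * (128 * kR ^+ 3) ^+ 2 = 8 * 128 ^+ 2 * kR ^+ 6 by ring.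
  by lra.
apply: le_trans (ler_wpM2l n0 hs) _; by rewrite le_eqVlt; apply/orP; left; apply/eqP; ring.
Qed.

Lemma exists_localized_functions : exists psi : 'I_k -> M -> R,
  [/\ forall l x, 0 <= psi l x,
      forall l m x, l != m -> psi l x = 0 \/ psi m x = 0,
      forall l, 2^-1 <= \sum_x nu x * psi l x ^+ 2 &
      forall l, \sum_x \sum_y w x y * (psi l x - psi l y) ^+ 2 <=
        2 ^+ 14 * k%:R ^+ 4 * \sum_x \sum_y w x y * sqdist (F x) (F y)].
Proof.
have kR_gt0 : 0 < kR by have := kR_ge1; lra.
have A0 : 0 < 2 * kR ^+ 2 by rewrite mulr_gt0 // exprn_gt0.
have [t []] := sum_le_exists2 N_gt0 A0 (fun t : 'I_N => energy_ge0 t)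
  (fun t => loss_ge0 t) sum_loss sum_energy.
have -> : 2 * (2 * kR ^+ 2) / N%:R = 4^-1.
  by rewrite NE; field; rewrite gt_eqF.
have -> : 2 * (8 * H%:R ^+ 2 * E) / N%:R = 2 ^+ 14 * kR ^+ 4 * E.
  by rewrite NE HE; field; rewrite gt_eqF.
move=> lossE energyE.
pose c := cutoff N K u t; pose Q := cube N K u t.
pose m (C : {set M}) := \sum_(x | Q x == C) nu x * sqnorm (F x) * c x ^+ 2.
have c_itv x : 0 <= c x <= 1 by exact: cutoff_itv.
have term0 x : 0 <= nu x * sqnorm (F x) by rewrite mulr_ge0 ?sqnorm_ge0.
have m0 C : 0 <= m C by apply: sumr_ge0 => x _; rewrite mulr_ge0 ?sqr_ge0.
(* Squared angular diameter of a cube: [2 k] coordinates, each varying by at most [1 / (4 k)]. *)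
pose tau : R := (8 * kR)^-1.
have tau0 : 0 < tau by rewrite invr_gt0 mulr_gt0.
have tauk : 8 * kR * tau = 1 by rewrite divff // gt_eqF // mulr_gt0.
have tau1 : tau <= 8^-1 by have := kR_ge1; nra.
have mb C : m C <= 1 + 2 * tau.
  apply: (@le_trans _ _ (\sum_(x | Q x == C) nu x * sqnorm (F x))).
    apply: ler_sum => x _; rewrite ler_piMr //.
    by have /andP[h0 h1] := c_itv x; rewrite expr_le1.
  apply: (mass_small_diameter nu_ge0 iso) => [|x y /eqP xC /eqP yC]; first by lra.
  have xy : Q x = Q y by rewrite xC yC.
  apply: (@le_trans _ _ (\sum_(i < k + k) (4 * kR)^-1 ^+ 2)); last first.
    rewrite sumr_const card_ord -[leLHS]mulr_natl natrD -/kR.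
    rewrite /tau le_eqVlt; apply/orP; left; apply/eqP; field.
    by rewrite gt_eqF.
  apply: ler_sum => i _; rewrite -[leLHS]real_normK ?num_real //.
  rewrite ler_sqr ?nnegrE ?invr_ge0 ?mulr_ge0 ?(ltW kR_gt0) //.
  have H0 : 0 < H%:R :> R by rewrite HE mulr_gt0 // exprn_gt0.
  have := cube_diameter N_gt0 u_itv i (ltn_ord t) xy.
  rewrite uB normrM (ger0_norm (ltW H0)) => h.
  rewrite -(ler_pM2l H0); apply: le_trans h _; rewrite NE HE.
  have -> : 128 * kR ^+ 3 / (4 * kR) = 32 * kR ^+ 2 by field; rewrite gt_eqF.
  have : 1 <= kR ^+ 2 by rewrite exprn_ege1.
  by lra.
have sum_m : \sum_(C in [set: {set M}]) m C = kR - loss t.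
  rewrite /m /loss /kR -[X in X - _]total -sumrB.
  rewrite [RHS](partition_big Q (mem [set: {set M}])) => [|x _]; last by rewrite inE.
  by apply: eq_bigr => C _; apply: eq_bigr => x _; rewrite /c; ring.
(* The mass left is at least [k - 1/4], and [(k - 1) (1 + 1 / (4 k)) + 1/2] does not exceed it, so
   [k] groups fit, numbered up to [k - 1]. *)
have [||g hg] := @exists_heavy_groups R _ m (1 + 2 * tau) m0 _ mb k.-1 [set: {set M}].
- by lra.
- rewrite sum_m.
  have -> : k.-1%:R = kR - 1 by rewrite -subn1 natrB.
  have -> : (kR - 1) * (1 + 2 * tau) = kR - 1 + 4^-1 * (8 * kR * tau) - 2 * tau by field.
  by rewrite tauk; lra.
pose chi (l : nat) x := if g (Q x) == l then c x else 0.
have chi_itv l x : 0 <= chi l x <= 1.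
  by rewrite /chi; case: ifP => // _; rewrite lexx ler01.
exists (fun l x => norm (F x) * chi l x); split.
- by move=> l x; have /andP[h _] := chi_itv l x; rewrite mulr_ge0 ?norm_ge0.
- move=> l l' x ll'; rewrite /chi; case: eqVneq => [->|_]; last by left; rewrite mulr0.
  by right; rewrite (negbTE (_ : (l : nat) != l')) ?mulr0.
- move=> l; have lk : (l <= k.-1)%N by rewrite -ltnS prednK.
  apply: le_trans (hg l lk) _; rewrite /m.
  rewrite [leRHS](partition_big Q xpredT) //= [leLHS]big_mkcond.
  apply: ler_sum => C _; rewrite inE /=; case: ifP => [/eqP gC|_]; last first.
    by apply: sumr_ge0 => x _; rewrite mulr_ge0 ?sqr_ge0.
  apply: ler_sum => x /eqP QxC.
  by rewrite /chi QxC gC eqxx exprMn sqr_norm [leRHS]mulrA.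
- move=> l; apply: le_trans energyE.
  apply: ler_sum => x _; apply: ler_sum => y _; rewrite ler_wpM2l //.
  apply: le_trans (sqr_scaled_diff_le (norm_ge0 _) (norm_ge0 _) (chi_itv l x) (chi_itv l y)) _.
  rewrite lerD2l ler_wpM2l ?mulr_ge0 ?norm_ge0 //.
  exact: (sqr_cutoff_diff_le N K u (fun C => g C == l)).
Qed.

End Localization.

(** * Steklov eigenfunctions *)

Lemma char_poly_similar (K : fieldType) n (P A B : 'M[K]_n) :
  P \in unitmx -> P *m A = B *m P -> char_poly A = char_poly B.
Proof.
move=> Pu PA; rewrite /char_poly /char_poly_mx.
set PP := map_mx polyC P.
have detP : \det PP != 0.
  by rewrite det_map_mx polyC_eq0 -unitfE -unitmxE.
have E : PP *m ('X%:M - map_mx polyC A) = ('X%:M - map_mx polyC B) *m PP.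
  by rewrite mulmxBr mulmxBl -!map_mxM PA scalar_mxC.
by apply: (mulfI detP); rewrite -det_mulmx E det_mulmx mulrC.
Qed.

(** * Spectral theorem for real matrices symmetric with respect to a weight *)

Section RealSpectral.
Variables (R : realType).

Local Notation toC := (real_complex R).
Local Notation conjC := (@Num.conj R[i]).

(* The rows of X + i Y are a unitary basis of complex eigenvectors.  Their real
   and imaginary parts are kept separately: twice as many real vectors satisfy
   the isotropy inequality, which is all that is needed, so no real orthonormal
   basis has to be constructed. *)
Lemma symmetric_diagonalization n (B : 'M[R]_n) : B^T = B ->
  exists (lam : 'rV[R]_n) (X Y : 'M[R]_n),
  [/\ char_poly B = \prod_(l < n) ('X - (lam 0 l)%:P),
      X *m B = diag_mx lam *m X, Y *m B = diag_mx lam *m Y,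
      X *m X^T + Y *m Y^T = 1%:M & X *m Y^T = Y *m X^T].
Proof.
move=> Bsym; pose BC := map_mx toC B.
have BCherm : BC \is hermsymmx.
  apply/is_hermitianmxP; rewrite expr0 scale1r; apply/matrixP => i j.
  rewrite !mxE -[in LHS]Bsym mxE.
  by apply/eqP; rewrite eq_complex /= oppr0 !eqxx.
have BCn := hermitian_normalmx BCherm.
have /orthomx_spectralP BE := BCn.
set P := spectralmx BC in BE; set D := spectral_diag BC in BE.
have Pu : P \in unitmx by exact: spectral_unit.
have PB : P *m BC = diag_mx D *m P by rewrite [BC in LHS]BE !mulmxA mulmxV // mul1mx.
pose lam := map_mx (@complex.Re R) D.
have lamE : D = map_mx toC lam.
  apply/matrixP => i j; rewrite !mxE RRe_real //.
  by have /mxOverP := hermitian_spectral_diag_real BCherm; exact.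
pose X := map_mx (@complex.Re R) P; pose Y := map_mx (@complex.Im R) P.
have PBij l j : \sum_i P l i * BC i j = D 0 l * P l j.
  by have /matrixP/(_ l j) := PB; rewrite mul_diag_mx !mxE.
have ReS (I : finType) (g : I -> R[i]) :
    complex.Re (\sum_i g i) = \sum_i complex.Re (g i).
  by apply: (big_morph (@complex.Re R)) => // -[a b] [c d].
have ImS (I : finType) (g : I -> R[i]) :
    complex.Im (\sum_i g i) = \sum_i complex.Im (g i).
  by apply: (big_morph (@complex.Im R)) => // -[a b] [c d].
have PPij l m : \sum_i P l i * conjC (P m i) = (l == m)%:R.
  have /unitarymxP/matrixP/(_ l m) := spectral_unitarymx BC.
  by rewrite -/P !mxE => <-; apply: eq_bigr => i _; rewrite !mxE.
exists lam, X, Y; split.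
- apply: (@map_poly_inj _ _ toC).
  rewrite map_char_poly -/BC (char_poly_similar Pu PB).
  rewrite map_prod_XsubC char_poly_trig ?diag_mx_is_trig //.
  by apply: eq_bigr => l _; rewrite !mxE eqxx mulr1n lamE !mxE.
(* [B] and the eigenvalues are real, so the eigenvector equation splits into real and imaginary
   parts. The last two goals split unitarity likewise. *)
- apply/matrixP => l j; rewrite mul_diag_mx !mxE.
  have := congr1 (@complex.Re R) (PBij l j); rewrite ReS lamE !mxE.
  case: (P l j) => p q /=; rewrite mul0r subr0 => <-; apply: eq_bigr => i _.
  by rewrite !mxE; case: (P l i) => a b /=; rewrite mulr0 subr0.
- apply/matrixP => l j; rewrite mul_diag_mx !mxE.
  have := congr1 (@complex.Im R) (PBij l j); rewrite ImS lamE !mxE.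
  case: (P l j) => p q /=; rewrite mul0r addr0 => <-; apply: eq_bigr => i _.
  by rewrite !mxE; case: (P l i) => a b /=; rewrite mulr0 add0r.
- apply/matrixP => l m; rewrite !mxE -big_split /=.
  have := congr1 (@complex.Re R) (PPij l m); rewrite ReS.
  have -> : complex.Re (l == m)%:R = (l == m)%:R :> R by case: eqP.
  move=> <-; apply: eq_bigr => i _.
  by rewrite !mxE; case: (P l i) (P m i) => [a b] [c d] /=; ring.
- apply/matrixP => l m; rewrite !mxE; apply/eqP; rewrite eq_sym -subr_eq0 -sumrB; apply/eqP.
  have := congr1 (@complex.Im R) (PPij l m); rewrite ImS.
  have -> : complex.Im (l == m)%:R = 0 :> R by case: eqP.
  move=> h; rewrite -[RHS]h; apply: eq_bigr => i _.
  by rewrite !mxE; case: (P l i) (P m i) => [a b] [c d] /=; ring.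
Qed.

Lemma sorted_nth_le (s : seq R) (i j : nat) : sorted <=%R s ->
  (i <= j < size s)%N -> nth 0 s i <= nth 0 s j.
Proof.
move=> ss /andP[ij js]; apply: (sorted_leq_nth (@le_trans _ R) (@lexx _ R)) => //.
by rewrite inE (leq_ltn_trans ij).
Qed.

(** The spectrum is the sorted list of the [lam 0 l], and [p] selects the indices of its first [k]
    entries. *)
Lemma spectrum_prod n (A : 'M[R]_n) (lam : 'rV[R]_n) (k : nat) :
  (0 < k <= n)%N -> char_poly A = \prod_(l < n) ('X - (lam 0 l)%:P) ->
  exists p : 'I_k -> 'I_n, injective p /\
    forall l, lam 0 (p l) <= nth 0 (spectrum A) k.-1.
Proof.
move=> /andP[k0 kn] AE; pose t := [seq lam 0 l | l <- enum 'I_n].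
have AEt : char_poly A = \prod_(a <- t) ('X - a%:P).
  by rewrite AE /t big_map big_enum.
have [sS sE] : is_spectrum A (spectrum A).
  apply: (@xgetPex _ [::] (is_spectrum A)); exists (sort <=%R t); split.
    by rewrite sort_sorted //; exact: le_total.
  by rewrite AEt; apply: perm_big; rewrite perm_sym perm_sort.
have st : perm_eq (spectrum A) t by apply: prod_XsubC_eq; rewrite -sE AEt.
have tn : size t = n by rewrite size_map size_enum_ord.
have sn : size (spectrum A) = n by rewrite (perm_size st).
have [Is IsP sIs] := perm_iotaP 0 st.
have szI : size Is = n by rewrite (perm_size IsP) size_iota.
have uI : uniq Is by rewrite (perm_uniq IsP) iota_uniq.
have In l : (l < k)%N -> (nth 0%N Is l < n)%N.
  move=> lk; have : nth 0%N Is l \in Is by apply: mem_nth; rewrite szI (leq_trans lk).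
  by rewrite (perm_mem IsP) mem_iota tn.
exists (fun l : 'I_k => Ordinal (In l (ltn_ord l))); split.
  move=> l m /(congr1 val) /= /eqP; rewrite nth_uniq ?szI ?(leq_trans (ltn_ord _)) //.
  by move=> /eqP/val_inj.
move=> l.
have -> : lam 0 (Ordinal (In l (ltn_ord l))) = nth 0 (spectrum A) l.
  rewrite sIs (nth_map 0%N) ?szI ?(leq_trans (ltn_ord l)) //.
  rewrite /t (nth_map (Ordinal (In l (ltn_ord l)))) ?size_enum_ord ?In //.
  by congr (lam 0 _); apply: val_inj; rewrite /= nth_enum_ord ?In.
apply: sorted_nth_le => //; rewrite sn -ltnS prednK // ltn_ord /=.
by rewrite (leq_trans _ kn) // prednK.
Qed.

(** Conjugation by the diagonal matrix of the [sqrt (m i)] makes [A] symmetric. The [2 k] functions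
    are the rescaled real and imaginary parts of [k] unitary eigenvectors, which explains the total
    mass [k]. *)
Lemma weighted_symmetric_eigenbasis n (A : 'M[R]_n) (m : 'I_n -> R) (k : nat) :
  (0 < k <= n)%N -> (forall i, 0 < m i) ->
  (forall i j, m i * A i j = m j * A j i) ->
  exists (lam : 'I_(k + k) -> R) (f : 'I_(k + k) -> 'I_n -> R),
  [/\ forall l, lam l <= nth 0 (spectrum A) k.-1,
      forall l i, \sum_j A i j * f l j = lam l * f l i,
      forall a : 'I_(k + k) -> R,
        \sum_i m i * (\sum_l a l * f l i) ^+ 2 <= \sum_l a l ^+ 2 &
      \sum_i m i * \sum_l f l i ^+ 2 = k%:R].
Proof.
move=> kn m0 Asym; pose r i := Num.sqrt (m i).
have r0 i : 0 < r i by rewrite sqrtr_gt0.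
have rn i : r i != 0 by rewrite gt_eqF.
have r2 i : m i = r i ^+ 2 by rewrite sqr_sqrtr // ltW.
pose B : 'M[R]_n := \matrix_(i, j) (r i * A i j / r j).
have Bsym : B^T = B.
  apply/matrixP => i j; rewrite !mxE; have := Asym i j; rewrite !r2 => h.
  apply: (mulfI (rn i)); apply: (mulfI (rn j)).
  have -> : r j * (r i * (r j * A j i / r i)) = r j ^+ 2 * A j i by field.
  by rewrite -h; field.
have [lam [X [Y [BE XB YB U1 U2]]]] := symmetric_diagonalization Bsym.
have AE : char_poly A = \prod_(l < n) ('X - (lam 0 l)%:P).
  rewrite -BE; apply: (@char_poly_similar _ _ (diag_mx (\row_i r i))).
    rewrite unitmxE det_diag unitfE; apply/prodf_neq0 => i _; rewrite mxE //.
  apply/matrixP => i j; rewrite mul_diag_mx mul_mx_diag !mxE.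
  by rewrite divfK.
have [p [pinj plam]] := spectrum_prod kn AE.
pose X' := rowsub p X; pose Y' := rowsub p Y; pose Z := col_mx X' Y'.
pose q (l : 'I_(k + k)) := match split l with inl i => p i | inr i => p i end.
have V1 : X' *m X'^T + Y' *m Y'^T = 1%:M.
  apply/matrixP => l l'; have /matrixP/(_ (p l) (p l')) := U1.
  rewrite !mxE (inj_eq pinj) => <-.
  by congr (_ + _); apply: eq_bigr => i _; rewrite !mxE.
have V2 : X' *m Y'^T = Y' *m X'^T.
  apply/matrixP => l l'; have /matrixP/(_ (p l) (p l')) := U2.
  rewrite !mxE => h; transitivity (\sum_j X (p l) j * Y^T j (p l')).
    by apply: eq_bigr => i _; rewrite !mxE.
  by rewrite h; apply: eq_bigr => i _; rewrite !mxE.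
have ZB l i : \sum_j Z l j * B j i = lam 0 (q l) * Z l i.
  rewrite /Z; case: (split_ordP l) => l' ->.
    rewrite /q (unsplitK (inl l')) col_mxEu mxE.
    have /matrixP/(_ (p l') i) := XB; rewrite mul_diag_mx !mxE => <-.
    by apply: eq_bigr => j _; rewrite col_mxEu !mxE.
  rewrite /q (unsplitK (inr l')) col_mxEd mxE.
  have /matrixP/(_ (p l') i) := YB; rewrite mul_diag_mx !mxE => <-.
  by apply: eq_bigr => j _; rewrite col_mxEd !mxE.
exists (fun l => lam 0 (q l)), (fun l i => Z l i / r i); split.
- by move=> l; rewrite /q; case: splitP => l' _; exact: plam.
- move=> l i; rewrite mulrA -ZB mulr_suml; apply: eq_bigr => j _.
  rewrite -Bsym !mxE; field.
  by rewrite !rn.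
- move=> a; pose c : 'rV[R]_(k + k) := \row_l a l.
  have -> : \sum_i m i * (\sum_l a l * (Z l i / r i)) ^+ 2 =
      \sum_i (c *m Z) 0 i ^+ 2.
    apply: eq_bigr => i _; rewrite r2 -exprMn; congr (_ ^+ 2).
    rewrite mulr_sumr mxE; apply: eq_bigr => l _; rewrite [c _ _]mxE; field.
    by rewrite rn.
  pose b1 := lsubmx c; pose b2 := rsubmx c.
  (* [c *m Z] and [d] are the real and imaginary parts of [(b1 - i b2) (X' + i Y')]. The rows of
     [X' + i Y'] being orthonormal, their squared norms add up to that of [c]. *)
  pose d := b1 *m Y' - b2 *m X'.
  have cE : c *m Z = b1 *m X' + b2 *m Y' by rewrite -{1}(hsubmxK c) mul_row_col.
  have sq s (v : 'rV[R]_s) : (v *m v^T) 0 0 = \sum_i v 0 i ^+ 2.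
    by rewrite mxE; apply: eq_bigr => i _; rewrite mxE expr2.
  have cc : c *m c^T = b1 *m b1^T + b2 *m b2^T.
    by rewrite -{1 2}(hsubmxK c) tr_row_mx mul_row_col.
  have key : (c *m Z) *m (c *m Z)^T + d *m d^T = c *m c^T.
    rewrite cc cE /d !(raddfD, raddfN) /= !trmx_mul.
    rewrite !(mulmxDl, mulmxDr, mulmxN, mulNmx, mulmxBl, mulmxBr).
    have -> : b1 *m b1^T = b1 *m (X' *m X'^T + Y' *m Y'^T) *m b1^T.
      by rewrite V1 mulmx1.
    have -> : b2 *m b2^T = b2 *m (X' *m X'^T + Y' *m Y'^T) *m b2^T.
      by rewrite V1 mulmx1.
    rewrite !(mulmxDl, mulmxDr) !mulmxA.
    have := congr1 (fun W => b1 *m W *m b2^T) V2; rewrite !mulmxA => ->.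
    have := congr1 (fun W => b2 *m W *m b1^T) V2; rewrite !mulmxA => ->.
    by apply/matrixP => x y; rewrite !mxE; ring.
  have -> : \sum_l a l ^+ 2 = (c *m c^T) 0 0.
    by rewrite sq; apply: eq_bigr => l _; rewrite mxE.
  rewrite -key -sq [leRHS]mxE lerDl sq sumr_ge0 // => i _; exact: sqr_ge0.
- have -> : \sum_i m i * \sum_l (Z l i / r i) ^+ 2 = \sum_i \sum_l Z l i ^+ 2.
    apply: eq_bigr => i _; rewrite mulr_sumr; apply: eq_bigr => l _.
    by rewrite r2; field; rewrite rn.
  rewrite exchange_big big_split_ord /= -big_split /=.
  rewrite -[RHS](mxtrace1 R k) -V1 /mxtrace; apply: eq_bigr => l _.
  rewrite !mxE; congr (_ + _); apply: eq_bigr => i _.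
    by rewrite /Z col_mxEu !mxE expr2.
  by rewrite /Z col_mxEd !mxE expr2.
Qed.

End RealSpectral.

(** * Harmonic extension, self-adjointness of the Steklov operator, spectral embedding *)

Section SteklovOperator.
Variables (R : realType) (M : finType) (V : {set M}).
Variables (L : M -> M -> R) (mu : M -> R).
Hypothesis V_neq0 : V != finset.set0.
Hypothesis L_markov : markov_generator L.
Hypothesis L_irr : irreducible_generator L.
Hypothesis mu_inv : invariant_probability L mu.
Hypothesis L_rev : reversible L mu.

Local Notation VT := {x : M | x \in V}.
Local Notation w := (edge_mass L mu).

(** Reversibility carries positivity of [mu] along each edge, and irreducibility joins a point of
    positive mass to [x]. *)
Lemma invariant_gt0 x : 0 < mu x.
Proof.
have [mu0 mu1 _] := mu_inv.
have step a b : 0 < mu a -> 0 < L a b -> 0 < mu b.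
  move=> ma ab; rewrite lt_def mu0 andbT; apply/eqP => mb.
  by have := L_rev a b; rewrite mb mul0r => /eqP; rewrite gt_eqF // mulr_gt0.
have [a ma] : exists a, 0 < mu a.
  apply/existsP; apply: contraT => /existsPn H; move: mu1; rewrite big1 => [/eqP|y _].
    by rewrite eq_sym oner_eq0.
  by apply/eqP; rewrite eq_le mu0 andbT leNgt H.
have /connectP[p hp ->] := L_irr a x.
elim: p a ma hp => //= b p IH a ma /andP[ab hp].
by apply: IH hp; exact: step ab.
Qed.

Let mu_gt0 := invariant_gt0.

Lemma sum_gen_act_sym (F G : {ffun M -> R}) :
  \sum_x mu x * G x * gen_act L F x = \sum_x mu x * F x * gen_act L G x.
Proof.
transitivity (\sum_x \sum_y mu x * L x y * (G x * F y)).
  apply: eq_bigr => x _; rewrite ffunE mulr_sumr; apply: eq_bigr => y _; ring.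
rewrite exchange_big /=; apply: eq_bigr => y _; rewrite ffunE mulr_sumr.
by apply: eq_bigr => x _; rewrite L_rev; ring.
Qed.

(** On expanding the square, the [F x ^+ 2] terms vanish by zero row sums and the [F y ^+ 2] terms
    by invariance. *)
Lemma dirichlet_sumE (F : {ffun M -> R}) :
  dirichlet_sum L mu F = - 2 * \sum_x mu x * F x * gen_act L F x.
Proof.
have [_ _ inv] := mu_inv.
have -> : dirichlet_sum L mu F = \sum_x \sum_y mu x * L x y * (F x - F y) ^+ 2.
  apply: eq_bigr => x _; apply: eq_bigr => y _; rewrite /edge_mass.
  by case: eqP => // ->; rewrite subrr expr0n !mulr0.
transitivity (\sum_x \sum_y (mu x * L x y * F x ^+ 2) +
   \sum_x \sum_y (mu x * L x y * F y ^+ 2) +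
   - 2 * \sum_x \sum_y (mu x * F x) * (L x y * F y)).
  rewrite mulr_sumr -!big_split; apply: eq_bigr => x _ /=.
  rewrite mulr_sumr -!big_split; apply: eq_bigr => y _ /=; ring.
rewrite [X in X + _ + _]big1 => [|x _]; last first.
  by rewrite -mulr_suml -mulr_sumr L_markov.2 mulr0 mul0r.
rewrite exchange_big [X in _ + X + _]big1 => [|y _]; last first.
  by rewrite -mulr_suml inv mul0r.
rewrite !add0r; congr (_ * _); apply: eq_bigr => x _.
by rewrite ffunE mulr_sumr.
Qed.

(** The energy of [F] vanishes, so [F] is constant along edges, and every point is joined to a point
    of [V]. *)
Lemma harmonic_ext_unique0 (F : {ffun M -> R}) :
  (forall x, x \notin V -> gen_act L F x = 0) ->
  (forall x, x \in V -> F x = 0) -> F = 0.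
Proof.
move=> FL FV.
have D0 : dirichlet_sum L mu F = 0.
  rewrite dirichlet_sumE big1 ?mulr0 // => x _.
  by case: (boolP (x \in V)) => xV; [rewrite FV // mulr0 mul0r|rewrite FL // mulr0].
have Fxy x y : 0 < L x y -> F x = F y.
  move=> Lxy; case: (eqVneq x y) => [-> //|xy].
  have w0 := edge_mass_ge0 L_markov mu_gt0.
  have t0 a b : 0 <= w a b * (F a - F b) ^+ 2 by rewrite mulr_ge0 ?sqr_ge0.
  have /psumr_eq0P/(_ D0)/(_ x isT) : forall a, true ->
      0 <= \sum_b w a b * (F a - F b) ^+ 2 by move=> a _; exact: sumr_ge0.
  move=> /(psumr_eq0P (fun b _ => t0 x b))/(_ y isT)/eqP.
  rewrite mulf_eq0 /edge_mass (negbTE xy) gt_eqF ?mulr_gt0 //=.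
  by rewrite expf_eq0 /= subr_eq0 => /eqP.
apply/ffunP => x; rewrite [RHS]ffunE.
have [v vV] := set0Pn _ V_neq0.
have /connectP[p hp xE] := L_irr x v.
rewrite -(FV v vV) xE; elim: p x hp {xE} => //= y p IH x /andP[xy hp].
by rewrite (Fxy _ _ xy) IH.
Qed.

Lemma is_harmonic_ext_unique f (F G : {ffun M -> R}) :
  is_harmonic_ext L f F -> is_harmonic_ext (V := V) L f G -> F = G.
Proof.
move=> [F1 F2] [G1 G2].
have : [ffun x => F x - G x] = 0.
  apply: harmonic_ext_unique0 => x xV.
    rewrite ffunE; under eq_bigr do rewrite ffunE mulrBr.
    by rewrite sumrB; have := F1 x xV; have := G1 x xV; rewrite !ffunE => -> ->; rewrite subrr.
  by rewrite ffunE (F2 (Sub x xV)) (G2 (Sub x xV)) subrr.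
move=> /ffunP E; apply/ffunP => x; have := E x; rewrite !ffunE => /eqP.
by rewrite subr_eq0 => /eqP.
Qed.

(** The extension problem is a square linear system, with identity rows on [V] and rows of [L]
    elsewhere; uniqueness makes it invertible. *)
Lemma exists_harmonic_ext f : exists F, is_harmonic_ext (V := V) L f F.
Proof.
pose B : 'M[R]_#|M| := \matrix_(i, j)
  (if enum_val i \in V then (i == j)%:R else L (enum_val i) (enum_val j)).
have BF (v : 'cV[R]_#|M|) i : (B *m v) i 0 =
    if enum_val i \in V then v i 0
    else gen_act L [ffun x => v (enum_rank x) 0] (enum_val i).
  rewrite mxE; case: ifPn => iV.
    rewrite (bigD1 i) //= mxE iV eqxx mul1r big1 ?addr0 // => j ji.
    by rewrite mxE iV eq_sym (negbTE ji) mul0r.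
  rewrite ffunE [RHS](reindex (@enum_val M M)) /=; last first.
    by apply: onW_bij; exact: enum_val_bij.
  by apply: eq_bigr => j _; rewrite mxE (negbTE iV) ffunE enum_valK.
have Bu : B \in unitmx.
  rewrite -unitmx_tr unitmxE unitfE; apply/det0P => -[v v0 vB].
  have Bv : B *m v^T = 0 by rewrite -[B]trmxK -trmx_mul vB trmx0.
  move/eqP: v0; apply; apply/rowP => i; rewrite mxE.
  have /ffunP/(_ (enum_val i)) : [ffun x => v^T (enum_rank x) 0] = 0 :> {ffun M -> R}.
    apply: harmonic_ext_unique0 => x xV.
      have := BF v^T (enum_rank x); rewrite Bv mxE enum_rankK (negbTE xV).
      exact: esym.
    by have := BF v^T (enum_rank x); rewrite Bv mxE enum_rankK xV ffunE => <-.
  by rewrite !ffunE enum_valK mxE.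
pose h (x : M) : R := if insub x is Some y then f y else 0.
pose b : 'cV[R]_#|M| := \col_i h (enum_val i).
pose v := invmx B *m b.
have Bv : B *m v = b by rewrite /v mulKVmx.
exists [ffun x => v (enum_rank x) 0]; split => [x xV|[x xV]].
  have := BF v (enum_rank x); rewrite Bv mxE enum_rankK (negbTE xV) => <-.
  by rewrite /h insubN.
have := BF v (enum_rank x); rewrite Bv mxE enum_rankK xV ffunE => <-.
by rewrite /h insubT.
Qed.

Lemma harmonic_extP f : is_harmonic_ext L f (harmonic_ext (V := V) L f).
Proof. by apply: (@xgetPex _ 0 (is_harmonic_ext L f)); exact: exists_harmonic_ext. Qed.

Let val_at (i : 'I_#|{: VT}|) : M := val (enum_val i).

Lemma sum_in_V (g : M -> R) : \sum_(x in V) g x = \sum_i g (val_at i).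
Proof.
rewrite (reindex_omap (val : VT -> M) insub) => [|x xV]; last by rewrite insubT.
rewrite (eq_bigl xpredT) => [|x]; last by rewrite valK eqxx andbT (valP x).
rewrite (reindex (fun i : 'I_#|{: VT}| => enum_val i)) //=.
by apply: onW_bij; exact: enum_val_bij.
Qed.

(** By uniqueness, superposing the extensions of indicators gives the extension of [f]; this is the
    linearity of the operator. *)
Lemma steklov_mx (f : {ffun VT -> R}) i :
  \sum_j op_mx (steklov (V := V) L) i j * f (enum_val j) = steklov L f (enum_val i).
Proof.
pose e (j : 'I_#|{: VT}|) : {ffun VT -> R} := [ffun z => (z == enum_val j)%:R].
pose F : {ffun M -> R} := [ffun x => \sum_j f (enum_val j) * harmonic_ext L (e j) x].
have FL x : gen_act L F x = \sum_j f (enum_val j) * gen_act L (harmonic_ext L (e j)) x.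
  rewrite ffunE; under eq_bigr do rewrite ffunE mulr_sumr.
  rewrite exchange_big /=; apply: eq_bigr => j _.
  by rewrite ffunE mulr_sumr; apply: eq_bigr => y _; ring.
have FE : F = harmonic_ext L f.
  apply: is_harmonic_ext_unique (harmonic_extP f); split => [x xV|x].
    rewrite FL big1 // => j _.
    by rewrite (harmonic_extP (e j)).1 ?mulr0.
  rewrite ffunE (bigD1 (enum_rank x)) //= big1 => [|j jx].
    by rewrite (harmonic_extP _).2 ffunE enum_rankK eqxx mulr1 addr0.
  rewrite (harmonic_extP _).2 ffunE -(enum_rankK x) (inj_eq enum_val_inj).
  by rewrite eq_sym (negbTE jx) mulr0.
rewrite ffunE -FE FL; apply: eq_bigr => j _.
by rewrite mxE ffunE mulrC.
Qed.

Lemma sum_harmonic_ext (f g : {ffun VT -> R}) :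
  \sum_x mu x * harmonic_ext L g x * gen_act L (harmonic_ext L f) x =
  \sum_i mu (val_at i) * g (enum_val i) * steklov L f (enum_val i).
Proof.
rewrite (bigID (mem V)) /= [X in _ + X]big1 ?addr0 => [|x xV]; last first.
  by rewrite (harmonic_extP f).1 ?mulr0.
rewrite sum_in_V; apply: eq_bigr => i _.
by rewrite (harmonic_extP g).2 [steklov _ _ _]ffunE.
Qed.

(** Symmetry of [L] for [mu], applied to harmonic extensions of indicators, whose images under [L]
    live on [V] only. *)
Lemma steklov_weighted_sym (i j : 'I_#|{: VT}|) :
  mu (val_at i) * op_mx (steklov (V := V) L) i j =
  mu (val_at j) * op_mx (steklov (V := V) L) j i.
Proof.
pose e (j : 'I_#|{: VT}|) : {ffun VT -> R} := [ffun z => (z == enum_val j)%:R].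
have pick a b : mu (val_at a) * op_mx (steklov (V := V) L) a b =
    \sum_c mu (val_at c) * e a (enum_val c) * steklov L (e b) (enum_val c).
  rewrite (bigD1 a) //= big1 => [|c ca].
    by rewrite addr0 mxE [e a _]ffunE eqxx mulr1.
  by rewrite [e a _]ffunE (inj_eq enum_val_inj) (negbTE ca) mulr0 mul0r.
by rewrite !pick -!sum_harmonic_ext sum_gen_act_sym.
Qed.

(** The coordinates of [F] extend the [2 k] eigenfunctions. Each has energy [2 lam l] times its
    mass, [lam l] is at most [sigma_k], and the masses add up to [k]. *)
Lemma exists_spectral_embedding (k : nat) : (0 < k <= #|V|)%N ->
  exists F : M -> 'I_(k + k) -> R,
  [/\ forall a : 'I_(k + k) -> R,
        \sum_x trace_measure V mu x * (\sum_l a l * F x l) ^+ 2 <= sqnorm a,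
      \sum_x trace_measure V mu x * sqnorm (F x) = k%:R &
      \sum_x \sum_y w x y * sqdist (F x) (F y) <= 2 * k%:R * sigma V L k].
Proof.
move=> kV; have kn : (0 < k <= #|{: VT}|)%N by rewrite card_sig.
have Asym (i j : 'I_#|{: VT}|) : mu (val_at i) * (- op_mx (steklov (V := V) L)) i j =
    mu (val_at j) * (- op_mx (steklov (V := V) L)) j i.
  by have := steklov_weighted_sym i j; rewrite !mxE !mulrN => ->.
have [lam [f [lam_le fE iso total]]] :=
  weighted_symmetric_eigenbasis kn (fun i => mu_gt0 (val_at i)) Asym.
pose phi l : {ffun VT -> R} := [ffun z => f l (enum_rank z)].
pose F x l := harmonic_ext L (phi l) x.
have FV i l : F (val_at i) l = f l i.
  by rewrite /F (harmonic_extP (phi l)).2 ffunE enum_valK.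
have traceE (g : M -> R) :
    \sum_x trace_measure V mu x * g x = \sum_i mu (val_at i) * g (val_at i).
  rewrite -(sum_in_V (fun x => mu x * g x)) [RHS]big_mkcond.
  by apply: eq_bigr => x _; rewrite /trace_measure; case: ifP; rewrite ?mul0r.
exists F; split.
- move=> a; rewrite traceE; apply: le_trans (iso a).
  by apply: ler_sum => i _; under eq_bigr do rewrite FV.
- rewrite traceE -total; apply: eq_bigr => i _; congr (_ * _).
  by apply: eq_bigr => l _; rewrite FV.
have -> : \sum_x \sum_y w x y * sqdist (F x) (F y) =
    \sum_l dirichlet_sum L mu (harmonic_ext L (phi l)).
  rewrite [RHS]exchange_big /=; apply: eq_bigr => x _.
  rewrite [RHS]exchange_big /=; apply: eq_bigr => y _.
  by rewrite mulr_sumr.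
have DE l : dirichlet_sum L mu (harmonic_ext L (phi l)) =
    2 * lam l * \sum_i mu (val_at i) * f l i ^+ 2.
  rewrite dirichlet_sumE sum_harmonic_ext !mulr_sumr; apply: eq_bigr => i _.
  have Sphi : steklov L (phi l) (enum_val i) = - (lam l * f l i).
    rewrite -steklov_mx -fE -sumrN; apply: eq_bigr => j _.
    by rewrite [in RHS]mxE ffunE enum_valK; ring.
  by rewrite Sphi ffunE enum_valK; ring.
have -> : 2 * k%:R * sigma V L k =
    \sum_l 2 * sigma V L k * \sum_i mu (val_at i) * f l i ^+ 2.
  rewrite -mulr_sumr exchange_big /= -total.
  under [in RHS]eq_bigr do rewrite -mulr_sumr.
  by ring.
apply: ler_sum => l _; rewrite DE ler_wpM2r //.
  by apply: sumr_ge0 => i _; rewrite mulr_ge0 ?sqr_ge0 // ltW.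
by rewrite ler_pM2l //; exact: lam_le.
Qed.

End SteklovOperator.

(** * Combination of the embedding, the localization and the Cheeger inequality *)

Theorem theorem1 (R : realType) :
  exists c0 : R, 0 < c0 /\
    forall (M : finType) (V : {set M}) (L : M -> M -> R) (mu : M -> R),
      V != finset.set0 -> V \proper [set: M] ->
      markov_generator L -> irreducible_generator L ->
      invariant_probability L mu -> reversible L mu ->
      forall k : nat, (1 <= k <= #|V|)%N ->
        ((c0 / k%:R ^+ 6)%:E
           * (cheeger_steklov V L mu k * ((gen_norm L)^-1)%:E)
         <= (sigma V L k)%:E)%E.
Proof.
(* The exponent collects [2^14] from localization, 2 from the doubled energy and 2 from masses of at
   least 1/2. *)
exists (2 ^- 16); split; first by rewrite invr_gt0 exprn_gt0.
move=> M V L mu V0 _ Lm Li mi Lr k kV; have /andP[k0 _] := kV.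
have mu0 := invariant_gt0 Li mi Lr.
have w0 := edge_mass_ge0 Lm mu0.
have [F [iso total energy]] := exists_spectral_embedding V0 Lm Li mi Lr kV.
set s := sigma V L k in energy *.
set E := \sum_x \sum_y _ in energy.
have kR0 : 0 < k%:R :> R by rewrite ltr0n.
have E0 : 0 <= E.
  by apply: sumr_ge0 => x _; apply: sumr_ge0 => y _; rewrite mulr_ge0 ?sqdist_ge0.
have s0 : 0 <= s.
  by rewrite -(@pmulr_rge0 _ (2 * k%:R)) ?mulr_gt0 //; exact: le_trans energy.
have [psi [psi0 psiD psiV psiE]] :=
  exists_localized_functions k0 w0 (trace_measure_ge0 V mu0) iso total.
set l := gen_norm L.
have l0 : 0 <= l by exact: bigmax_ge_id.
pose q := l * (2 ^+ 16 * k%:R ^+ 5 * s).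
have q0 : 0 <= q by rewrite !mulr_ge0 ?exprn_ge0.
have cheeger_le : (cheeger_steklov V L mu k <= q%:E)%E.
  apply: (cheeger_steklov_le Lm Lr mu0 psi0 psiD) => j.
    by apply: lt_le_trans (psiV j).
  apply: (@le_trans _ _ (q * 2^-1)); last by rewrite ler_wpM2l.
  rewrite /q -mulrA ler_wpM2l //; apply: le_trans (psiE j) _; rewrite -/E.
  apply: (@le_trans _ _ (2 ^+ 14 * k%:R ^+ 4 * (2 * k%:R * s))).
    by rewrite ler_wpM2l // mulr_ge0 ?exprn_ge0.
  by rewrite le_eqVlt; apply/orP; left; apply/eqP; field.
have c0 : 0 <= 2 ^- 16 / k%:R ^+ 6 :> R by rewrite divr_ge0 ?invr_ge0 ?exprn_ge0.
apply: (@le_trans _ _ ((2 ^- 16 / k%:R ^+ 6)%:E * (q%:E * (l^-1)%:E))%E).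
  by apply: lee_wpmul2l; rewrite ?lee_fin //; apply: lee_wpmul2r; rewrite ?lee_fin ?invr_ge0.
rewrite -!EFinM lee_fin.
have -> : 2 ^- 16 / k%:R ^+ 6 * (q / l) = (l / l) * (s / k%:R).
  rewrite /q; move: l^-1 => li; field.
  by rewrite gt_eqF.
(* Only [l / l <= 1] is used, which also covers [l = 0], where the inverse is 0. The remaining
   factor [1 / k] is slack, [q] being of order [k^5]. *)
apply: (@le_trans _ _ (1 * (s / k%:R))).
  apply: ler_wpM2r; first by rewrite divr_ge0 // ltW.
  by have [->|ln] := eqVneq l 0; rewrite ?mul0r ?ler01 ?divff.
by rewrite mul1r ler_pdivrMr // ler_peMr // ler1n.
Qed.
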